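(* Let $\{\mathcal C_\alpha\}_{\alpha\in I}$, $\{\mathcal D_\beta\}_{\beta\in J}$ be finite families of unitary fusion categories with $|I|+|J|=N$, and let $\mathcal M$ be an indecomposable finitely semisimple unitary $\{\mathcal C_\alpha\}_{\alpha\in I}|\{\mathcal D_\beta\}_{\beta\in J}$ multimodule category, with associated tube $N$-tuple algebra. Then for any $1\le k\le N$ and any subsets $I'\subset I$, $J'\subset J$ with $|I'|+|J'|=k$, the tube $k$-tuple algebra constructed from $\mathcal M$ regarded as a $\{\mathcal C_\alpha\}_{\alpha\in I'}|\{\mathcal D_\beta\}_{\beta\in J'}$ multimodule category admits a weak Hopf algebra embedding into the tube $N$-tuple algebra of $\mathcal M$.
   Context: A multimodule category has pairwise coherently commuting left actions of all $\mathcal C_\alpha$ and right actions of all $\mathcal D_\beta$; equivalently it is a bimodule category over $\mathcal C=\boxtimes_\alpha\mathcal C_\alpha$ and $\mathcal D=\boxtimes_\beta\mathcal D_\beta$. Fix orders $I=\{1,\dots,p\}$, $J=\{1,\dots,q\}$ (subsets carry the induced order). Write $a=\boxtimes_i a_i\in\mathrm{Irr}(\mathcal C)$, $b=\boxtimes_jb_j\in\mathrm{Irr}(\mathcal D)$, $a\otimes m\otimes b=a_p\otimes\cdots\otimes a_1\otimes m\otimes b_1\otimes\cdots\otimes b_q$; associators are suppressed. $\bar a$: dual; $R_a:\mathbb 1\to\bar a\otimes a$, $\bar R_a:\mathbb 1\to a\otimes\bar a$: standard balanced solutions of the conjugate equations with $R_a^\dagger R_a=\bar R_a^\dagger\bar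 R_a=d_a$ (quantum dimension). $d^{L,i}_m,d^{R,j}_m>0$: quantum dimensions of $m\in\mathrm{Irr}(\mathcal M)$ for the $\mathcal C_i$- and $\mathcal D_j$-actions ($d_cd^{L,i}_m=\sum_n\dim\mathrm{Hom}(c\otimes m,n)d^{L,i}_n$ for $c\in \mathrm{Irr}(\mathcal C_i)$, similarly on the right). Dual bases: $\tau_p^*\tau_q=\delta_{pq}\mathrm{id}$. The tube $N$-tuple algebra is the multimodule domain wall tube algebra (which the paper obtains by gluing the $N$ boundary tube algebras of the individual actions): the weak Hopf algebra $\mathbf{Tube}=\bigoplus_{a,b}\bigoplus_{x,z,u,w\in\mathrm{Irr}(\mathcal M)}\mathrm{Hom}(x,a\otimes z\otimes b)\otimes\mathrm{Hom}(a\otimes u\otimes b,w)$ with - $1=\sum_{x,u}\mathrm{id}_x\otimes\mathrm{id}_u$ ($a=b=\mathbb 1$); - $(f\otimes g)(f'\otimes g')=\delta_{u,w'}\delta_{z,x'}\sum_{c,s,\tau,\sigma}[(\tau^*\otimes\mathrm{id}_{z'}\otimes\sigma^* )(\mathrm{id}_a\otimes f'\otimes\mathrm{id}_b)f]\otimes[g(\mathrm{id}_a\otimes g'\otimes\mathrm{id}_b)(\tau\otimes\mathrm{id}_{u'}\otimes\sigma)]$, $\tau,\sigma$ over bases of $\mathrm{Hom}(c,a\otimes a')$, $\mathrm{Hom}(s,b'\otimes b)$, $c\in\mathrm{Irr}(\mathcal C)$, $s\in\mathrm{Irr}(\mathcal D)$; - $\varepsilon(f\otimes g)=0$ unless $z=u,x=w$,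 and then $gf=\varepsilon(f\otimes g)\mathrm{id}_x$; - $\Delta(f\otimes g)=\sum_{s,t,e}(e\otimes g)\otimes(f\otimes e^* )$, $e,e^*$ dual bases of $\mathrm{Hom}(t,a\otimes s\otimes b)$, $\mathrm{Hom}(a\otimes s\otimes b,t)$; - for $g$ the composite of morphisms $a_i\otimes u_i\to u_{i+1}$ ($1\le i\le p$, $u_1=u$, $u_{p+1}=v_1$) and then $v_j\otimes b_j\to v_{j+1}$ ($1\le j\le q$, $v_{q+1}=w$) with all $u_i,v_j\in\mathrm{Irr}(\mathcal M)$: $S(f\otimes g)=\prod_i\frac{d^{L,i}_{u_i}}{d^{L,i}_{u_{i+1}}}\prod_j\frac{d^{R,j}_{v_j}}{d^{R,j}_{v_{j+1}}}\,\hat g\otimes\hat f$, $\hat g=(\mathrm{id}_{\bar a}\otimes g\otimes\mathrm{id}_{\bar b})(R_a\otimes\mathrm{id}_u\otimes\bar R_b)$, $\hat f=(R_a^\dagger\otimes\mathrm{id}_z\otimes\bar R_b^\dagger)(\mathrm{id}_{\bar a}\otimes f\otimes\mathrm{id}_{\bar b})$. *)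

(* Defs.v *)
From HB Require Import structures.
From mathcomp Require Import all_boot all_order all_algebra.
From mathcomp Require Import complex reals.

Set Implicit Arguments.
Unset Strict Implicit.
Unset Printing Implicit Defensive.

Import Order.TTheory GRing.Theory Num.Theory.
Local Open Scope ring_scope.

(* The ground field is R[i] with R : realType: the complex numbers.           *)

(* A C-linear dagger category with finite-dimensional morphism spaces and     *)
(* finite (orthogonal) direct sums, n = 0 in ucat_dsum being the zero object. *)
(* In this setting properness of the dagger (ucat_pos) amounts to being a     *)
(* C*-category: a finite-dimensional complex *-algebra in which f^* f = 0     *)
(* forces f = 0 is a C*-algebra.                                              *)
Record unitary_cat (R : realType) := UnitaryCat {
  obj :> Type;
  hom : obj -> obj -> vectType R[i];
  idm : forall x, hom x x;
  comp : forall x y z, hom y z -> hom x y -> hom x z;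
  dag : forall x y, hom x y -> hom y x;
  ucat_comp1l : forall x y (f : hom x y), comp (idm y) f = f;
  ucat_comp1r : forall x y (f : hom x y), comp f (idm x) = f;
  ucat_compA : forall x y z t (h : hom z t) (g : hom y z) (f : hom x y),
    comp h (comp g f) = comp (comp h g) f;
  ucat_compl : forall x y z (f : hom x y), linear (fun g : hom y z => comp g f);
  ucat_compr : forall x y z (g : hom y z), linear (fun f : hom x y => comp g f);
  ucat_dagK : forall x y (f : hom x y), dag (dag f) = f;
  ucat_dag_comp : forall x y z (g : hom y z) (f : hom x y),
    dag (comp g f) = comp (dag f) (dag g);
  ucat_dag_id : forall x, dag (idm x) = idm x;
  ucat_dagP : forall x y (a : R[i]) (f g : hom x y),
    dag (a *: f + g) = a^* *: dag f + dag g;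
  ucat_pos : forall x y (f : hom x y), comp (dag f) f = 0 -> f = 0;
  ucat_dsum : forall n (y : 'I_n -> obj),
    exists (x : obj) (v : forall j, hom (y j) x),
      [/\ forall j, comp (dag (v j)) (v j) = idm (y j),
          forall j l, j != l -> comp (dag (v j)) (v l) = 0
        & \sum_j comp (v j) (dag (v j)) = idm x]
}.

Arguments hom {R u} x y.
Arguments idm {R u} x.
Arguments comp {R u x y z} g f.
Arguments dag {R u x y} f.

Local Notation "g ∘ f" := (comp g f) (at level 40, left associativity).
Local Notation "f ^†" := (dag f) (at level 2, format "f ^†").

Definition hdim (R : realType) (M : unitary_cat R) (x y : M) : nat :=
  \dim {: hom x y}.

Definition unitary (R : realType) (M : unitary_cat R) (x y : M)
    (f : hom x y) : Prop := f^† ∘ f = idm x /\ f ∘ f^† = idm y.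

Definition isomorphic (R : realType) (M : unitary_cat R) (x y : M) : Prop :=
  exists (f : hom x y) (g : hom y x), g ∘ f = idm x /\ f ∘ g = idm y.

(* x is the orthogonal direct sum of the objects y j.                         *)
Definition is_dsum (R : realType) (M : unitary_cat R) n (x : M)
    (y : 'I_n -> M) : Prop :=
  exists v : forall j, hom (y j) x,
    [/\ forall j, (v j)^† ∘ v j = idm (y j),
        forall j l, j != l -> (v j)^† ∘ v l = 0
      & \sum_j v j ∘ (v j)^† = idm x].

(* Finitely semisimple unitary categories, with a chosen family irrv of       *)
(* representatives of the isomorphism classes of simple objects.              *)
Record ss_cat (R : realType) := SsCat {
  ss_ucat :> unitary_cat R;
  irr : finType;
  irrv : irr -> ss_ucat;
  irr_simple : forall i, hdim (irrv i) (irrv i) = 1%N;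
  irr_inj : forall i j, isomorphic (irrv i) (irrv j) -> i = j;
  irr_dec : forall x : ss_ucat, exists n (l : 'I_n -> irr),
    is_dsum x (fun j => irrv (l j))
}.

Arguments irrv {R _} i.

(* delta_{i,j} id, as a morphism between the chosen simple objects.           *)
Definition didm (R : realType) (M : ss_cat R) (i j : irr M) :
    hom (irrv i) (irrv j) :=
  if i =P j is ReflectT e then
    eq_rect i (fun l => hom (irrv i) (irrv l)) (idm (irrv i)) j e
  else 0.

(* The scalar s with f = s id, for f an endomorphism of a simple object.      *)
Definition scal (R : realType) (M : unitary_cat R) (x : M) (f : hom x x) :
  R[i] := coord [tuple idm x] ord0 f.

(* The library's basis of Hom(c,x) and, for c simple, the basis of Hom(x,c)   *)
(* dual to it: dbas p ∘ bas q = delta_{p,q} id.  It is computed from the      *)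
(* Gram matrix of the basis.                                                  *)
Definition bas (R : realType) (M : unitary_cat R) (c x : M)
  (p : 'I_(hdim c x)) : hom c x := (vbasis {: hom c x})`_p.

Definition gram (R : realType) (M : unitary_cat R) (c x : M) :
  'M[R[i]]_(hdim c x) := \matrix_(p, q) scal ((bas p)^† ∘ bas q).

Definition dbas (R : realType) (M : unitary_cat R) (c x : M)
  (p : 'I_(hdim c x)) : hom x c :=
  \sum_q invmx (gram c x) p q *: (bas q)^†.

Section DualBases.

Variables (R : realType) (M : unitary_cat R).
Implicit Types x y z c : M.

Lemma comp0l x y z (f : hom x y) : (0 : hom y z) ∘ f = 0.
Proof.
have := ucat_compl f (-1) (0 : hom y z) 0.
by rewrite !scaler0 !addr0 scaleN1r addNr.
Qed.

Lemma comp0r x y z (g : hom y z) : g ∘ (0 : hom x y) = 0.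
Proof.
have := ucat_compr g (-1) (0 : hom x y) 0.
by rewrite !scaler0 !addr0 scaleN1r addNr.
Qed.

Lemma compZl x y z a (g : hom y z) (f : hom x y) : (a *: g) ∘ f = a *: (g ∘ f).
Proof. by have := ucat_compl f a g 0; rewrite comp0l !addr0. Qed.

Lemma compZr x y z a (g : hom y z) (f : hom x y) : g ∘ (a *: f) = a *: (g ∘ f).
Proof. by have := ucat_compr g a f 0; rewrite comp0r !addr0. Qed.

Lemma compDl x y z (g g' : hom y z) (f : hom x y) :
  (g + g') ∘ f = g ∘ f + g' ∘ f.
Proof. by have := ucat_compl f 1 g g'; rewrite !scale1r. Qed.

Lemma compDr x y z (g : hom y z) (f f' : hom x y) :
  g ∘ (f + f') = g ∘ f + g ∘ f'.
Proof. by have := ucat_compr g 1 f f'; rewrite !scale1r. Qed.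

Lemma comp_suml x y z I (r : seq I) (g : I -> hom y z) (f : hom x y) :
  (\sum_(i <- r) g i) ∘ f = \sum_(i <- r) g i ∘ f.
Proof. exact: (big_morph (fun g => g ∘ f) (fun g g' => compDl g g' f) (comp0l _ _)). Qed.

Lemma comp_sumr x y z I (r : seq I) (g : hom y z) (f : I -> hom x y) :
  g ∘ (\sum_(i <- r) f i) = \sum_(i <- r) g ∘ f i.
Proof. exact: (big_morph (fun f => g ∘ f) (compDr g) (comp0r _ _)). Qed.

Lemma dag0 x y : (0 : hom x y)^† = 0.
Proof.
have := ucat_dagP (-1) (0 : hom x y) 0.
rewrite !scaler0 !addr0 => {1}->.
by rewrite rmorphN rmorph1 scaleN1r addNr.
Qed.

Lemma dagD x y (f g : hom x y) : (f + g)^† = f^† + g^†.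
Proof. by have := ucat_dagP 1 f g; rewrite rmorph1 !scale1r. Qed.

Lemma dagZ x y a (f : hom x y) : (a *: f)^† = a^* *: f^†.
Proof. by have := ucat_dagP a f 0; rewrite dag0 !addr0. Qed.

Lemma dag_sum x y I (r : seq I) (f : I -> hom x y) :
  (\sum_(i <- r) f i)^† = \sum_(i <- r) (f i)^†.
Proof. exact: (big_morph dag (@dagD _ _) (dag0 _ _)). Qed.

Lemma hom_decomp c x (f : hom c x) :
  f = \sum_p coord (vbasis {: hom c x}) p f *: bas p.
Proof. exact: coord_vbasis (memvf f). Qed.

Section Simple.

Variables (c : M) (c1 : hdim c c = 1%N).

Lemma simple_id_neq0 : idm c != 0.
Proof.
apply/eqP => c0; suff: hdim c c = 0%N by rewrite c1.
apply/eqP; rewrite dimv_eq0 -subv0; apply/subvP => f _.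
by rewrite memv0 -(ucat_comp1l f) c0 comp0l eqxx.
Qed.

Lemma scalE (f : hom c c) : f = scal f *: idm c.
Proof.
have fr : free [tuple idm c] by rewrite seq1_free simple_id_neq0.
suff ff : f \in <<[tuple idm c]>>%VS by rewrite [LHS](coord_span ff) big_ord1.
suff -> : (<<[tuple idm c]>> = {: hom c c})%VS by exact: memvf.
by apply/eqP; rewrite eqEdim subvf /= -/(hdim c c) c1 (eqP fr).
Qed.

Lemma scalZ a : scal (a *: idm c) = a.
Proof.
have := scalE (a *: idm c); move/eqP.
by rewrite -subr_eq0 -scalerBl scaler_eq0 (negPf simple_id_neq0) orbF subr_eq0 => /eqP.
Qed.

Lemma gram_unit x : gram c x \in unitmx.
Proof.
rewrite -row_free_unit -kermx_eq0; apply/eqP/row_matrixP => i.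
set v := row i _; rewrite row0.
have : v *m gram c x = 0 by rewrite /v -row_mul mulmx_ker row0.
move: v => v vG.
pose h : hom c x := \sum_p (v 0 p)^* *: bas p.
have hb (q : 'I_(hdim c x)) : h^† ∘ bas q = 0.
  rewrite dag_sum comp_suml.
  have -> : \sum_p ((v 0 p)^* *: bas p)^† ∘ bas q
            = \sum_p (v 0 p * scal ((bas p)^† ∘ bas q)) *: idm c.
    apply: eq_bigr => p _.
    by rewrite dagZ conjCK compZl {1}[_ ∘ _]scalE scalerA.
  rewrite -scaler_suml; move/rowP/(_ q): vG; rewrite !mxE => vGq.
  rewrite (_ : \sum_p _ = 0) ?scale0r // -[RHS]vGq.
  by apply: eq_bigr => p _; rewrite mxE.
have h0 : h = 0.
  apply: ucat_pos; rewrite {2}/h comp_sumr big1 // => p _.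
  by rewrite compZr hb scaler0.
apply/rowP => p; rewrite mxE.
have /freeP fr : free (vbasis {: hom c x}) by exact: basis_free (vbasisP _).
have /(_ p) := fr (fun p => (v 0 p)^*) h0.
by move/eqP; rewrite conjC_eq0 => /eqP.
Qed.

Lemma dbas_bas x (p r : 'I_(hdim c x)) :
  dbas p ∘ bas r = (p == r)%:R *: idm c.
Proof.
rewrite /dbas comp_suml.
have -> : \sum_q (invmx (gram c x) p q *: (bas q)^†) ∘ bas r
          = \sum_q (invmx (gram c x) p q * gram c x q r) *: idm c.
  apply: eq_bigr => q _.
  by rewrite compZl mxE -scalerA -scalE.
rewrite -scaler_suml; congr (_ *: _).
by move/matrixP/(_ p r): (mulVmx (gram_unit x)); rewrite !mxE.
Qed.

Lemma dbas_decomp x (g : hom x c) : g = \sum_p scal (g ∘ bas p) *: dbas p.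
Proof.
apply/eqP; rewrite -subr_eq0; set k := (X in X == 0).
have kb (q : 'I_(hdim c x)) : k ∘ bas q = 0.
  rewrite /k -scaleN1r compDl compZl comp_suml.
  rewrite (bigD1 q) //= big1 => [|p pq].
    by rewrite compZl dbas_bas eqxx scale1r addr0 -scalE scaleN1r subrr.
  by rewrite compZl dbas_bas (negPf pq) scale0r scaler0.
have k0 : k^† = 0.
  apply: ucat_pos; rewrite ucat_dagK [X in _ ∘ X](hom_decomp k^†).
  by rewrite comp_sumr big1 // => p _; rewrite compZr kb scaler0.
by rewrite -(ucat_dagK k) k0 dag0.
Qed.

End Simple.

End DualBases.

Lemma schur (R : realType) (M : ss_cat R) (i j : irr M)
    (f : hom (irrv i) (irrv j)) : i != j -> f = 0.
Proof.
move=> /eqP ij; have [//|f0] := eqVneq f 0; case: ij; apply: irr_inj.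
have e1 := scalE (irr_simple i) (f^† ∘ f).
have e2 := scalE (irr_simple j) (f ∘ f^†).
have s1 : scal (f^† ∘ f) != 0.
  apply: contra_neq f0 => s0.
  by apply: ucat_pos; rewrite e1 s0 scale0r.
have s2 : scal (f ∘ f^†) != 0.
  apply: contra_neq f0 => s0.
  rewrite -(ucat_dagK f) (_ : f^† = 0) ?dag0 //.
  by apply: ucat_pos; rewrite ucat_dagK e2 s0 scale0r.
exists f, ((scal (f^† ∘ f))^-1 *: f^†).
have h1 : (scal (f^† ∘ f))^-1 *: f^† ∘ f = idm (irrv i).
  by rewrite compZl e1 scalZ ?irr_simple // scalerA mulVf // scale1r.
split=> //.
have : (scal (f ∘ f^†))^-1 *: (f ∘ f^†) = idm (irrv j).
  by rewrite e2 scalZ ?irr_simple // scalerA mulVf // scale1r.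
move=> h2.
suff -> : (scal (f^† ∘ f))^-1 *: f^† = (scal (f ∘ f^†))^-1 *: f^†.
  by rewrite compZr.
rewrite -[LHS]ucat_comp1r -{1}h2 compZr ucat_compA h1 ucat_comp1l.
by [].
Qed.

(* The data include, for each simple a, a simple dual and a standard solution *)
(* (R_a, \bar R_a) of the conjugate equations.  As every object is a direct   *)
(* sum of simple ones, this makes the category rigid.  The unit is simple by  *)
(* irr1m; it is only required to be isomorphic to its representative.         *)
Record fusion_cat (R : realType) := FusionCat {
  fc_cat :> ss_cat R;
  tens : fc_cat -> fc_cat -> fc_cat;
  tensm : forall x x' y y' : fc_cat,
    hom x x' -> hom y y' -> hom (tens x y) (tens x' y');
  tunit : fc_cat;
  assoc : forall x y z, hom (tens (tens x y) z) (tens x (tens y z));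
  lunit : forall x, hom (tens tunit x) x;
  runit : forall x, hom (tens x tunit) x;
  irr1 : irr fc_cat;
  irr1m : hom tunit (irrv irr1);
  dual : irr fc_cat -> irr fc_cat;
  coevR : forall a, hom tunit (tens (irrv (dual a)) (irrv a));
  coevRb : forall a, hom tunit (tens (irrv a) (irrv (dual a)));
  qdimc : irr fc_cat -> R;
  fc_tensm_id : forall x y, tensm (idm x) (idm y) = idm (tens x y);
  fc_tensm_comp : forall x x' x'' y y' y'' (f' : hom x' x'') (f : hom x x')
    (g' : hom y' y'') (g : hom y y'),
    tensm (f' ∘ f) (g' ∘ g) = tensm f' g' ∘ tensm f g;
  fc_tensml : forall x x' y y' (g : hom y y'),
    linear (fun f : hom x x' => tensm f g);
  fc_tensmr : forall x x' y y' (f : hom x x'),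
    linear (fun g : hom y y' => tensm f g);
  fc_tensm_dag : forall x x' y y' (f : hom x x') (g : hom y y'),
    (tensm f g)^† = tensm f^† g^†;
  fc_assoc_u : forall x y z, unitary (assoc x y z);
  fc_lunit_u : forall x, unitary (lunit x);
  fc_runit_u : forall x, unitary (runit x);
  fc_assoc_nat : forall x x' y y' z z' (f : hom x x') (g : hom y y')
    (h : hom z z'),
    assoc x' y' z' ∘ tensm (tensm f g) h = tensm f (tensm g h) ∘ assoc x y z;
  fc_lunit_nat : forall x x' (f : hom x x'),
    lunit x' ∘ tensm (idm tunit) f = f ∘ lunit x;
  fc_runit_nat : forall x x' (f : hom x x'),
    runit x' ∘ tensm f (idm tunit) = f ∘ runit x;
  fc_pentagon : forall x y z t,
    assoc x y (tens z t) ∘ assoc (tens x y) z t =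
    tensm (idm x) (assoc y z t) ∘ assoc x (tens y z) t
      ∘ tensm (assoc x y z) (idm t);
  fc_triangle : forall x y,
    tensm (idm x) (lunit y) ∘ assoc x tunit y = tensm (runit x) (idm y);
  fc_irr1_u : unitary irr1m;
  fc_conj : forall a,
    lunit (irrv a) ∘ tensm (coevRb a)^† (idm (irrv a))
      ∘ (assoc (irrv a) (irrv (dual a)) (irrv a))^†
      ∘ tensm (idm (irrv a)) (coevR a) ∘ (runit (irrv a))^† = idm (irrv a);
  fc_conjb : forall a,
    lunit (irrv (dual a)) ∘ tensm (coevR a)^† (idm (irrv (dual a)))
      ∘ (assoc (irrv (dual a)) (irrv a) (irrv (dual a)))^†
      ∘ tensm (idm (irrv (dual a))) (coevRb a) ∘ (runit (irrv (dual a)))^†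
    = idm (irrv (dual a));
  fc_qdim : forall a, (coevR a)^† ∘ coevR a = (qdimc a)%:C%C *: idm tunit;
  fc_qdimb : forall a, (coevRb a)^† ∘ coevRb a = (qdimc a)%:C%C *: idm tunit
}.

Arguments tunit {R _}.
Arguments irr1 {R _}.
Arguments irr1m {R _}.

Section MonoidalOpposite.

Lemma unitary_dag (R : realType) (M : unitary_cat R) (x y : M) (f : hom x y) :
  unitary f -> unitary f^†.
Proof. by move=> [h1 h2]; split; rewrite ucat_dagK. Qed.

Variables (R : realType) (C : fusion_cat R).

Let dagI (x y : C) (f g : hom x y) : f^† = g^† -> f = g.
Proof. by move=> h; rewrite -(ucat_dagK f) h ucat_dagK. Qed.

Lemma mop_assoc_nat (x x' y y' z z' : C) (f : hom x x') (g : hom y y')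
    (h : hom z z') :
  (assoc z' y' x')^† ∘ tensm h (tensm g f) =
  tensm (tensm h g) f ∘ (assoc z y x)^†.
Proof.
have [u1 _] := fc_assoc_u z' y' x'; have [_ u2] := fc_assoc_u z y x.
rewrite -[LHS]ucat_comp1r -u2 ucat_compA; congr (_ ∘ _).
by rewrite -ucat_compA -fc_assoc_nat ucat_compA u1 ucat_comp1l.
Qed.

Lemma mop_pentagon (x y z t : C) :
  (assoc (tens t z) y x)^† ∘ (assoc t z (tens y x))^† =
  tensm (assoc t z y)^† (idm x) ∘ (assoc t (tens z y) x)^†
    ∘ tensm (idm t) (assoc z y x)^†.
Proof.
apply: dagI; rewrite !ucat_dag_comp !fc_tensm_dag !ucat_dagK !ucat_dag_id.
by rewrite fc_pentagon !ucat_compA.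
Qed.

Lemma mop_triangle (x y : C) :
  tensm (runit y) (idm x) ∘ (assoc y tunit x)^† = tensm (idm y) (lunit x).
Proof.
have [_ u] := fc_assoc_u y tunit x.
by rewrite -fc_triangle -ucat_compA u ucat_comp1r.
Qed.

(* The conjugate equations in the form needed for the reversed product.       *)
Lemma mop_conj (a : irr C) :
  runit (irrv a) ∘ tensm (idm (irrv a)) (coevR a)^†
    ∘ ((assoc (irrv a) (irrv (dual a)) (irrv a))^†)^†
    ∘ tensm (coevRb a) (idm (irrv a)) ∘ (lunit (irrv a))^† = idm (irrv a).
Proof.
apply: dagI; rewrite !ucat_dag_comp !fc_tensm_dag !ucat_dagK !ucat_dag_id.
by rewrite !ucat_compA fc_conj.
Qed.

Lemma mop_conjb (a : irr C) :
  runit (irrv (dual a)) ∘ tensm (idm (irrv (dual a))) (coevRb a)^†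
    ∘ ((assoc (irrv (dual a)) (irrv a) (irrv (dual a)))^†)^†
    ∘ tensm (coevR a) (idm (irrv (dual a))) ∘ (lunit (irrv (dual a)))^†
  = idm (irrv (dual a)).
Proof.
apply: dagI; rewrite !ucat_dag_comp !fc_tensm_dag !ucat_dagK !ucat_dag_id.
by rewrite !ucat_compA fc_conjb.
Qed.

(* C with the reversed tensor product; R_a and \bar R_a are exchanged.        *)
Definition mop : fusion_cat R := {|
  fc_cat := C;
  tens := fun x y => tens y x;
  tensm := fun x x' y y' f g => tensm g f;
  tunit := tunit;
  assoc := fun x y z => (assoc z y x)^†;
  lunit := fun x => runit x;
  runit := fun x => lunit x;
  irr1 := irr1;
  irr1m := irr1m;
  dual := fun a => dual a;
  coevR := fun a => coevRb a;
  coevRb := fun a => coevR a;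
  qdimc := fun a => qdimc a;
  fc_tensm_id := fun x y => fc_tensm_id y x;
  fc_tensm_comp := fun x x' x'' y y' y'' f' f g' g => fc_tensm_comp g' g f' f;
  fc_tensml := fun x x' y y' g => @fc_tensmr R C y y' x x' g;
  fc_tensmr := fun x x' y y' f => @fc_tensml R C y y' x x' f;
  fc_tensm_dag := fun x x' y y' f g => fc_tensm_dag g f;
  fc_assoc_u := fun x y z => unitary_dag (fc_assoc_u z y x);
  fc_lunit_u := fun x => fc_runit_u x;
  fc_runit_u := fun x => fc_lunit_u x;
  fc_assoc_nat := fun x x' y y' z z' f g h => mop_assoc_nat f g h;
  fc_lunit_nat := fun x x' f => fc_runit_nat f;
  fc_runit_nat := fun x x' f => fc_lunit_nat f;
  fc_pentagon := mop_pentagon;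
  fc_triangle := mop_triangle;
  fc_irr1_u := fc_irr1_u C;
  fc_conj := mop_conj;
  fc_conjb := mop_conjb;
  fc_qdim := fun a => fc_qdimb a;
  fc_qdimb := fun a => fc_qdim a
|}.

End MonoidalOpposite.

Record left_module (R : realType) (C : fusion_cat R) (M : unitary_cat R) :=
  LeftModule {
  act :> C -> M -> M;
  actm : forall (c c' : C) (m m' : M),
    hom c c' -> hom m m' -> hom (act c m) (act c' m');
  massoc : forall c c' m, hom (act (tens c c') m) (act c (act c' m));
  munit : forall m, hom (act tunit m) m;
  lm_actm_id : forall c m, actm (idm c) (idm m) = idm (act c m);
  lm_actm_comp : forall c c' c'' m m' m'' (f' : hom c' c'') (f : hom c c')
    (g' : hom m' m'') (g : hom m m'),
    actm (f' ∘ f) (g' ∘ g) = actm f' g' ∘ actm f g;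
  lm_actml : forall c c' m m' (g : hom m m'),
    linear (fun f : hom c c' => actm f g);
  lm_actmr : forall c c' m m' (f : hom c c'),
    linear (fun g : hom m m' => actm f g);
  lm_actm_dag : forall c c' m m' (f : hom c c') (g : hom m m'),
    (actm f g)^† = actm f^† g^†;
  lm_massoc_u : forall c c' m, unitary (massoc c c' m);
  lm_munit_u : forall m, unitary (munit m);
  lm_massoc_nat : forall c c1 c' c1' m m1 (f : hom c c1) (f' : hom c' c1')
    (g : hom m m1),
    massoc c1 c1' m1 ∘ actm (tensm f f') g = actm f (actm f' g) ∘ massoc c c' m;
  lm_munit_nat : forall m m1 (g : hom m m1),
    munit m1 ∘ actm (idm tunit) g = g ∘ munit m;
  lm_pentagon : forall c c' c'' m,
    massoc c c' (act c'' m) ∘ massoc (tens c c') c'' m =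
    actm (idm c) (massoc c' c'' m) ∘ massoc c (tens c' c'') m
      ∘ actm (assoc c c' c'') (idm m);
  lm_triangle : forall c m,
    actm (idm c) (munit m) ∘ massoc c tunit m = actm (runit c) (idm m)
}.

Definition right_module (R : realType) (D : fusion_cat R) (M : unitary_cat R) :=
  left_module (mop D) M.

Definition commutor (R : realType) (C D : fusion_cat R) (M : unitary_cat R)
    (A : left_module C M) (B : left_module D M) : Type :=
  forall c d m, hom (A c (B d m)) (B d (A c m)).

(* The isomorphisms t make the actions A and B commute coherently; t' is the  *)
(* inverse of t.  Compatibility of t with the product and the unit of D is    *)
(* obtained by exchanging the roles of (A, t) and (B, t').                    *)
Record coherent (R : realType) (C D : fusion_cat R) (M : unitary_cat R)
    (A : left_module C M) (B : left_module D M)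
    (t : commutor A B) (t' : commutor B A) : Prop := Coherent {
  comm_u : forall c d m, unitary (t c d m);
  comm_inv : forall c d m, t' d c m ∘ t c d m = idm (A c (B d m));
  comm_nat : forall c c' d d' m m' (f : hom c c') (g : hom d d')
    (h : hom m m'),
    t c' d' m' ∘ actm A f (actm B g h) = actm B g (actm A f h) ∘ t c d m;
  comm_assoc : forall c c' d m,
    actm B (idm d) (massoc A c c' m) ∘ t (tens c c') d m =
    t c d (A c' m) ∘ actm A (idm c) (t c' d m) ∘ massoc A c c' (B d m);
  comm_unit : forall d m,
    actm B (idm d) (munit A m) ∘ t tunit d m = munit A (B d m)
}.

(* The two ways of reversing the order of three commuting actions agree.      *)
Definition coherent3 (R : realType) (C D E : fusion_cat R) (M : unitary_cat R)
    (A1 : left_module C M) (A2 : left_module D M) (A3 : left_module E M)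
    (t12 : commutor A1 A2) (t13 : commutor A1 A3) (t23 : commutor A2 A3) :
    Prop :=
  forall c d e m,
    actm A3 (idm e) (t12 c d m) ∘ t13 c e (A2 d m)
      ∘ actm A1 (idm c) (t23 d e m) =
    t23 d e (A1 c m) ∘ actm A2 (idm d) (t13 c e m) ∘ t12 c d (A3 e m).

(* All actions are indexed by 'I_p + 'I_q, right actions being regarded as    *)
(* left actions of the reversed categories.                                   *)
Definition actor (R : realType) (p q : nat) (C : 'I_p -> fusion_cat R)
    (D : 'I_q -> fusion_cat R) (k : 'I_p + 'I_q) : fusion_cat R :=
  match k with inl i => C i | inr j => mop (D j) end.

Definition joint_act (R : realType) (p q : nat) (C : 'I_p -> fusion_cat R)
    (D : 'I_q -> fusion_cat R) (M : unitary_cat R)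
    (A : forall i, left_module (C i) M) (B : forall j, right_module (D j) M)
    (k : 'I_p + 'I_q) : left_module (actor C D k) M :=
  match k with inl i => A i | inr j => B j end.

(* mm_comm k k is never used: the laws only concern distinct indices.         *)
Record multimodule (R : realType) (p q : nat) (C : 'I_p -> fusion_cat R)
    (D : 'I_q -> fusion_cat R) := Multimodule {
  mm_cat :> ss_cat R;
  mm_left : forall i, left_module (C i) mm_cat;
  mm_right : forall j, right_module (D j) mm_cat;
  mm_act := joint_act mm_left mm_right;
  mm_comm : forall k l, commutor (mm_act k) (mm_act l);
  mm_coh : forall k l, k != l -> coherent (@mm_comm k l) (@mm_comm l k);
  mm_coh3 : forall k l n, k != l -> k != n -> l != n ->
    coherent3 (@mm_comm k l) (@mm_comm k n) (@mm_comm l n)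
}.

Arguments mm_act {R p q C D} _ k.
Arguments mm_comm {R p q C D} _ k l c d m.

(* P and Q are full multimodule subcategories with M = P (+) Q.               *)
Record is_decomposition (R : realType) (p q : nat) (C : 'I_p -> fusion_cat R)
    (D : 'I_q -> fusion_cat R) (M : multimodule C D) (P Q : M -> Prop) : Prop :=
  Decomposition {
  dec_actl : forall k c m, P m -> P (mm_act M k c m);
  dec_actr : forall k c m, Q m -> Q (mm_act M k c m);
  dec_orth : forall m n, P m -> Q n -> forall f : hom m n, f = 0;
  dec_sum : forall m, exists (n1 n2 : M), [/\ P n1, Q n2 &
    is_dsum m (fun j : 'I_2 => if j == ord0 then n1 else n2)]
}.

Definition indecomposable (R : realType) (p q : nat) (C : 'I_p -> fusion_cat R)
    (D : 'I_q -> fusion_cat R) (M : multimodule C D) : Prop :=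
  (exists m : M, idm m <> 0) /\
  forall P Q : M -> Prop, is_decomposition P Q ->
    (forall m, P m -> idm m = 0) \/ (forall m, Q m -> idm m = 0).

(* Quantum dimensions of the simple objects of M for each of the actions;     *)
(* they are unique up to a scalar on each connected component.                *)
Record qdims (R : realType) (p q : nat) (C : 'I_p -> fusion_cat R)
    (D : 'I_q -> fusion_cat R) (M : multimodule C D) := QDims {
  qdim :> 'I_p + 'I_q -> irr M -> R;
  qdim_gt0 : forall k m, 0 < qdim k m;
  qdim_eq : forall k (c : irr (actor C D k)) m,
    qdimc c * qdim k m =
    \sum_n (hdim (mm_act M k (irrv c) (irrv m)) (irrv n))%:R * qdim k n
}.

(* M as a multimodule category over the subfamilies given by I' and J'; the   *)
(* enumeration enum_val is increasing, so these carry the induced order.      *)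
Section Restriction.

Variables (R : realType) (p q : nat) (C : 'I_p -> fusion_cat R).
Variables (D : 'I_q -> fusion_cat R) (M : multimodule C D).
Variables (I' : {set 'I_p}) (J' : {set 'I_q}).

Definition subfam (n : nat) (S : {set 'I_n}) (F : 'I_n -> fusion_cat R)
  (i : 'I_#|S|) : fusion_cat R := F (enum_val i).

Definition subidx (k : 'I_#|I'| + 'I_#|J'|) : 'I_p + 'I_q :=
  match k with inl i => inl (enum_val i) | inr j => inr (enum_val j) end.

Lemma subidx_inj : injective subidx.
Proof. by case=> i [] j // [] /enum_val_inj ->. Qed.

Definition rleft (i : 'I_#|I'|) : left_module (subfam C i) M :=
  mm_left M (enum_val i).

Definition rright (j : 'I_#|J'|) : right_module (subfam D j) M :=
  mm_right M (enum_val j).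

Definition rcomm (k l : 'I_#|I'| + 'I_#|J'|) :
    commutor (joint_act rleft rright k) (joint_act rleft rright l) :=
  match k, l with
  | inl i, inl j => mm_comm M (inl (enum_val i)) (inl (enum_val j))
  | inl i, inr j => mm_comm M (inl (enum_val i)) (inr (enum_val j))
  | inr i, inl j => mm_comm M (inr (enum_val i)) (inl (enum_val j))
  | inr i, inr j => mm_comm M (inr (enum_val i)) (inr (enum_val j))
  end.

Lemma rcoh k l : k != l -> coherent (@rcomm k l) (@rcomm l k).
Proof.
rewrite -(inj_eq subidx_inj).
by case: k => i; case: l => j; exact: mm_coh.
Qed.

Lemma rcoh3 k l n : k != l -> k != n -> l != n ->
  coherent3 (@rcomm k l) (@rcomm k n) (@rcomm l n).
Proof.
rewrite -!(inj_eq subidx_inj).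
by case: k => i; case: l => j; case: n => h; exact: mm_coh3.
Qed.

Definition mm_restrict : multimodule (subfam (S := I') C) (subfam (S := J') D) :=
  Multimodule rcoh rcoh3.

Variable d : qdims M.

Definition rqdim (k : 'I_#|I'| + 'I_#|J'|) (m : irr M) : R := d (subidx k) m.

Lemma rqdim_gt0 k m : 0 < rqdim k m. Proof. exact: qdim_gt0. Qed.

Lemma rqdim_eq k (c : irr (actor (subfam (S := I') C) (subfam (S := J') D) k))
    (m : irr mm_restrict) :
  qdimc c * rqdim k m =
  \sum_n (hdim (mm_act mm_restrict k (irrv c) (irrv m)) (irrv n))%:R * rqdim k n.
Proof. by case: k c => i c; [exact: (qdim_eq d (k := inl (enum_val i)) c m)
                     |exact: (qdim_eq d (k := inr (enum_val i)) c m)].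
Qed.

Definition rqdims : qdims mm_restrict :=
  QDims (M := mm_restrict) rqdim_gt0 rqdim_eq.

End Restriction.

(* Underlying spaces are free on a finite basis.  Only the structure maps are *)
(* recorded: an embedding is an injective linear map preserving all of them.  *)

Section BasedSpaces.

Variable R : realType.

Definition vec (B : finType) := {ffun B -> R[i]^o}.

Definition evec (B : finType) (b : B) : vec B := [ffun b' => (b' == b)%:R].

(* vec B (x) vec B' is vec (B * B').                                          *)
Definition vtens (B B' : finType) (X : vec B) (Y : vec B') :
  vec (B * B')%type := [ffun b => X b.1 * Y b.2].

(* phi (x) phi, for phi linear.                                               *)
Definition vtens_map (B B' : finType) (phi : vec B -> vec B')
    (X : vec (B * B)%type) : vec (B' * B')%type :=
  \sum_b X b *: vtens (phi (evec b.1)) (phi (evec b.2)).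

Record weak_hopf_data (B : finType) := WeakHopfData {
  hmul : vec B -> vec B -> vec B;
  hone : vec B;
  hcomul : vec B -> vec (B * B)%type;
  hcounit : vec B -> R[i]^o;
  hantip : vec B -> vec B
}.

Record weak_hopf_embedding (B B' : finType) (H : weak_hopf_data B) (H' : weak_hopf_data B')
    (phi : vec B -> vec B') : Prop := WeakHopfEmbedding {
  whe_linear : linear phi;
  whe_inj : injective phi;
  whe_mul : forall X Y, phi (hmul H X Y) = hmul H' (phi X) (phi Y);
  whe_one : phi (hone H) = hone H';
  whe_comul : forall X, hcomul H' (phi X) = vtens_map phi (hcomul H X);
  whe_counit : forall X, hcounit H' (phi X) = hcounit H X;
  whe_antip : forall X, phi (hantip H X) = hantip H' (phi X)
}.

End BasedSpaces.

Section Tube.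

Variables (R : realType) (p q : nat) (C : 'I_p -> fusion_cat R).
Variables (D : 'I_q -> fusion_cat R) (M : multimodule C D).
Variable d : qdims M.

Notation K := ('I_p + 'I_q)%type.
Notation A k := (mm_act M k).
Notation F k := (actor C D k).
Notation objs := (forall k : K, F k).

(* Iterated actions along a list of indices whose head acts last; the word    *)
(* used below lists the right actions in decreasing order and then the left   *)
(* actions in decreasing order, so that all left actions are performed first, *)
(* giving (a_p (x) ... (x) a_1 (x) m) (x) b_1 (x) ... (x) b_q.                *)
Definition word : seq K :=
  rev ([seq inl i | i <- enum 'I_p] ++ [seq inr j | j <- enum 'I_q]).

Fixpoint wact (s : seq K) (a : objs) (m : M) : M :=
  if s is k :: s' then A k (a k) (wact s' a m) else m.

Fixpoint wactm (s : seq K) (a b : objs) (f : forall k, hom (a k) (b k))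
    (m n : M) (g : hom m n) : hom (wact s a m) (wact s b n) :=
  match s return hom (wact s a m) (wact s b n) with
  | [::] => g
  | k :: s' => actm (A k) (f k) (wactm s' f g)
  end.

Fixpoint wunit (s : seq K) (m : M) : hom (wact s (fun k => tunit) m) m :=
  match s return hom (wact s (fun k => tunit) m) m with
  | [::] => idm m
  | k :: s' => wunit s' m ∘ munit (A k) _
  end.

(* Moves one more action of index k past the actions in s.                    *)
Fixpoint wpush (s : seq K) (k : K) (c : F k) (a : objs) (m : M) :
    hom (A k c (wact s a m)) (wact s a (A k c m)) :=
  match s return hom (A k c (wact s a m)) (wact s a (A k c m)) with
  | [::] => idm _
  | l :: s' => actm (A l) (idm (a l)) (wpush s' c a m)
                 ∘ mm_comm M k l c (a l) (wact s' a m)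
  end.

(* (a (x) a') (x) m -> a (x) (a' (x) m), for s without repetition.            *)
Fixpoint wassoc (s : seq K) (a a' : objs) (m : M) :
    hom (wact s (fun k => tens (a k) (a' k)) m) (wact s a (wact s a' m)) :=
  match s return
    hom (wact s (fun k => tens (a k) (a' k)) m) (wact s a (wact s a' m)) with
  | [::] => idm m
  | k :: s' =>
      actm (A k) (idm (a k)) (wpush s' (a' k) a (wact s' a' m))
        ∘ massoc (A k) (a k) (a' k) (wact s' a (wact s' a' m))
        ∘ actm (A k) (idm (tens (a k) (a' k))) (wassoc s' a a' m)
  end.

(* Simple objects of the product of all the C_i and D_j.                      *)
Definition label := {dffun forall k : K, irr (F k)}.

Definition lobj (a : label) : objs := fun k => irrv (a k).

Definition lone : label := [ffun k => irr1].
Definition ldual (a : label) : label := [ffun k => dual (a k)].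

Definition tact (a : label) (m : M) : M := wact word (lobj a) m.

Definition tactm (a : label) (m n : M) (g : hom m n) :
  hom (tact a m) (tact a n) := wactm word (fun k => idm (lobj a k)) g.

(* m = 1 (x) m                                                                *)
Definition tunitm (m : M) : hom (tact lone m) m :=
  wunit word m
    ∘ wactm word (fun k => irr1m^† ∘ didm (lone k) irr1) (idm m).

(* R_a (x) id_m                                                               *)
Definition tcoev (a : label) (m : M) : hom m (tact (ldual a) (tact a m)) :=
  wassoc word (lobj (ldual a)) (lobj a) m
    ∘ wactm word (fun k =>
        tensm (didm (dual (a k)) (ldual a k)) (idm (lobj a k)) ∘ coevR (a k))
        (idm m)
    ∘ (wunit word m)^†.

(* Basis of Hom(c, a (x) a') for the product category, together with the      *)
(* induced morphisms c (x) m -> a (x) (a' (x) m) and back.                    *)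
Definition fus (c a a' : label) :=
  {dffun forall k : K, 'I_(hdim (lobj c k) (tens (lobj a k) (lobj a' k)))}.

Definition tsplit (c a a' : label) (t : fus c a a') (m : M) :
    hom (tact c m) (tact a (tact a' m)) :=
  wassoc word (lobj a) (lobj a') m ∘ wactm word (fun k => bas (t k)) (idm m).

Definition tfuse (c a a' : label) (t : fus c a a') (m : M) :
    hom (tact a (tact a' m)) (tact c m) :=
  wactm word (fun k => dbas (t k)) (idm m)
    ∘ (wassoc word (lobj a) (lobj a') m)^†.

(* Index (a, (x, z), (u, w)) of Hom(x, a (x) z (x) b) (x) Hom(a (x) u (x) b,  *)
(* w), both a and b being recorded in the label.                              *)
Definition tidx := (label * (irr M * irr M) * (irr M * irr M))%type.

Definition hom1 (a : label) (x z : irr M) : vectType R[i] :=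
  hom (irrv x) (tact a (irrv z)).
Definition hom2 (a : label) (u w : irr M) : vectType R[i] :=
  hom (tact a (irrv u)) (irrv w).

Definition tdim1 (t : tidx) := \dim {: hom1 t.1.1 t.1.2.1 t.1.2.2}.
Definition tdim2 (t : tidx) := \dim {: hom2 t.1.1 t.2.1 t.2.2}.

Definition tbasis : finType := {t : tidx & ('I_(tdim1 t) * 'I_(tdim2 t))%type}.

(* f (x) g, as an element of the direct sum.                                  *)
Definition pure (a : label) (x z u w : irr M) (f : hom1 a x z) (g : hom2 a u w) :
    vec R tbasis :=
  \sum_(i < tdim1 (a, (x, z), (u, w))) \sum_(j < tdim2 (a, (x, z), (u, w)))
    (coord (vbasis {: hom1 a x z}) i f * coord (vbasis {: hom2 a u w}) j g)
      *: evec R (Tagged (fun t : tidx => ('I_(tdim1 t) * 'I_(tdim2 t))%type)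
                        (i, j)).

(* The linear map sending f (x) g to phi f g, for phi bilinear.               *)
Definition ext (V : lmodType R[i])
    (phi : forall a x z u w, hom1 a x z -> hom2 a u w -> V)
    (X : vec R tbasis) : V :=
  \sum_(b : tbasis) X b *:
    phi (tag b).1.1 (tag b).1.2.1 (tag b).1.2.2 (tag b).2.1 (tag b).2.2
      (vbasis {: hom1 (tag b).1.1 (tag b).1.2.1 (tag b).1.2.2})`_(tagged b).1
      (vbasis {: hom2 (tag b).1.1 (tag b).2.1 (tag b).2.2})`_(tagged b).2.

(* The Kronecker deltas are provided by didm.                                 *)
Definition tmul (X Y : vec R tbasis) : vec R tbasis :=
  ext (fun a x z u w (f : hom1 a x z) (g : hom2 a u w) =>
    ext (fun a' x' z' u' w' (f' : hom1 a' x' z') (g' : hom2 a' u' w') =>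
      \sum_(c : label) \sum_(t : fus c a a')
        pure (tfuse t (irrv z') ∘ tactm a (f' ∘ didm z x') ∘ f : hom1 c x z')
             (g ∘ tactm a (didm w' u ∘ g') ∘ tsplit t (irrv u') : hom2 c u' w))
      Y) X.

Definition tone : vec R tbasis :=
  \sum_(x : irr M) \sum_(u : irr M)
    pure ((tunitm (irrv x))^† : hom1 lone x x) (tunitm (irrv u) : hom2 lone u u).

Definition tcounit (X : vec R tbasis) : R[i]^o :=
  ext (V := R[i]^o) (fun a x z u w (f : hom1 a x z) (g : hom2 a u w) =>
    scal (didm w x ∘ g ∘ tactm a (didm z u) ∘ f)) X.

Definition tcomul (X : vec R tbasis) : vec R (tbasis * tbasis)%type :=
  ext (fun a x z u w (f : hom1 a x z) (g : hom2 a u w) =>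
    \sum_(s : irr M) \sum_(t : irr M)
      \sum_(e < hdim (irrv t) (tact a (irrv s)))
        vtens (pure (bas e : hom1 a t s) g) (pure f (dbas e : hom2 a s t))) X.

(* If g is the composite of morphisms a_k (x) v_k -> v'_k with all v_k, v'_k  *)
(* simple, then wweight g is g times the product of the d^k_{v_k}/d^k_{v'_k}; *)
(* a general g is a sum of such composites (see wweight_nil, wweight_cons).   *)
Fixpoint wweight (s : seq K) (a : objs) (u w : irr M) :
    hom (wact s a (irrv u)) (irrv w) -> hom (wact s a (irrv u)) (irrv w) :=
  match s return
    hom (wact s a (irrv u)) (irrv w) -> hom (wact s a (irrv u)) (irrv w) with
  | [::] => fun g => g
  | k :: s' => fun g =>
      \sum_(v : irr M) \sum_(e < hdim (irrv v) (wact s' a (irrv u)))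
        (d k v / d k w)%:C%C *:
          (g ∘ actm (A k) (idm (a k)) (bas e)
             ∘ actm (A k) (idm (a k)) (wweight (dbas e)))
  end.

Definition ghat (a : label) (u w : irr M) (g : hom2 a u w) :
    hom1 (ldual a) u w :=
  tactm (ldual a) g ∘ tcoev a (irrv u).

Definition fhat (a : label) (x z : irr M) (f : hom1 a x z) :
    hom2 (ldual a) x z :=
  (tcoev a (irrv z))^† ∘ tactm (ldual a) f.

Definition tantip (X : vec R tbasis) : vec R tbasis :=
  ext (fun a x z u w (f : hom1 a x z) (g : hom2 a u w) =>
    pure (ghat (wweight g : hom2 a u w)) (fhat f)) X.

Definition tube : weak_hopf_data R tbasis :=
  WeakHopfData tmul tone tcomul tcounit tantip.

End Tube.

Section TubeFacts.

Variables (R : realType) (p q : nat) (C : 'I_p -> fusion_cat R).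
Variables (D : 'I_q -> fusion_cat R) (M : multimodule C D).
Variable d : qdims M.

Notation K := ('I_p + 'I_q)%type.

(* On f (x) g, the extension of a bilinear phi is phi f g.                    *)
Lemma ext_pure (V : lmodType R[i])
    (phi : forall (a : label C D) (x z u w : irr M), hom1 a x z -> hom2 a u w -> V) a x z u w
    (f : hom1 a x z) (g : hom2 a u w) :
  (forall g, linear (fun f => phi a x z u w f g)) ->
  (forall f, linear (fun g => phi a x z u w f g)) ->
  ext phi (pure f g) = phi a x z u w f g.
Proof.
move=> phil phir.
have ext_lin : linear (ext phi).
  move=> c X Y; rewrite /ext scaler_sumr -big_split /=.
  by apply: eq_bigr => b _; rewrite !ffunE scalerDl scalerA.
pose E : {linear vec R (tbasis M) -> V} :=
  HB.pack (ext phi) (GRing.isLinear.Build _ _ _ _ _ ext_lin).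
pose P1 g' : {linear hom1 a x z -> V} :=
  HB.pack (fun f => phi a x z u w f g')
    (GRing.isLinear.Build _ _ _ _ _ (phil g')).
pose P2 f' : {linear hom2 a u w -> V} :=
  HB.pack (fun g => phi a x z u w f' g)
    (GRing.isLinear.Build _ _ _ _ _ (phir f')).
have Ee b : E (evec R b) =
    phi (tag b).1.1 (tag b).1.2.1 (tag b).1.2.2 (tag b).2.1 (tag b).2.2
      (vbasis {: hom1 (tag b).1.1 (tag b).1.2.1 (tag b).1.2.2})`_(tagged b).1
      (vbasis {: hom2 (tag b).1.1 (tag b).2.1 (tag b).2.2})`_(tagged b).2.
  rewrite /E /= /ext (bigD1 b) //= big1 ?addr0 => [|b' bb'].
    by rewrite ffunE eqxx scale1r.
  by rewrite ffunE (negPf bb') scale0r.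
have phi1 : phi a x z u w f g = \sum_i coord (vbasis {: hom1 a x z}) i f *:
    phi a x z u w (vbasis {: hom1 a x z})`_i g.
  rewrite -[LHS]/(P1 g f) {1}(coord_vbasis (memvf f)) linear_sum.
  by apply: eq_bigr => i _; rewrite linearZ.
have phi2 f' : phi a x z u w f' g = \sum_j coord (vbasis {: hom2 a u w}) j g *:
    phi a x z u w f' (vbasis {: hom2 a u w})`_j.
  rewrite -[LHS]/(P2 f' g) {1}(coord_vbasis (memvf g)) linear_sum.
  by apply: eq_bigr => i _; rewrite linearZ.
rewrite -[LHS]/(E _) /pure linear_sum phi1; apply: eq_bigr => i _.
rewrite linear_sum phi2 scaler_sumr; apply: eq_bigr => j _.
by rewrite linearZ scalerA; congr (_ *: _); exact: (Ee (Tagged _ (i, j))).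
Qed.

Lemma wweight_linear s a u w :
  linear (@wweight R p q C D M d s a u w).
Proof.
case: s => [|k s] //= c g g'.
rewrite scaler_sumr -big_split; apply: eq_bigr => v _ /=.
rewrite scaler_sumr -big_split; apply: eq_bigr => e _ /=.
rewrite !compDl !compZl scalerDr; congr (_ + _).
by rewrite !scalerA mulrC.
Qed.

Lemma wweight_nil a u w (g : hom (irrv u) (irrv w)) :
  wweight (s := [::]) (a := a) d g = g.
Proof. by []. Qed.

Lemma wweight_cons k s a u v w
    (h : hom (mm_act M k (a k) (irrv v)) (irrv w))
    (g : hom (wact s a (irrv u)) (irrv v)) :
  wweight (s := k :: s) (a := a) d (h ∘ actm (mm_act M k) (idm (a k)) g) =
  (d k v / d k w)%:C%C *:
    (h ∘ actm (mm_act M k) (idm (a k)) (wweight d g)).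
Proof.
pose ac x y (f : hom x y) := actm (mm_act M k) (idm (a k)) f.
have acM x y z (f : hom y z) (f' : hom x y) : ac _ _ f ∘ ac _ _ f' = ac _ _ (f ∘ f').
  by rewrite /ac -lm_actm_comp ucat_comp1l.
have ac_lin x y : linear (ac x y) by exact: lm_actmr.
have ac0 x y : ac x y 0 = 0.
  have := ac_lin x y (-1) 0 0; rewrite !scaler0 !addr0 => {1}->.
  by rewrite scaleN1r addNr.
have acZ x y b f : ac x y (b *: f) = b *: ac x y f.
  by have := ac_lin x y b f 0; rewrite ac0 !addr0.
have acD x y f g' : ac x y (f + g') = ac x y f + ac x y g'.
  by have := ac_lin x y 1 f g'; rewrite !scale1r.
pose W : {linear hom (wact s a (irrv u)) (irrv v)
                  -> hom (wact s a (irrv u)) (irrv v)} :=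
  HB.pack (@wweight R p q C D M d s a u v)
    (GRing.isLinear.Build _ _ _ _ _ (@wweight_linear s a u v)).
rewrite /= (bigD1 v) //= [X in _ + X]big1 ?addr0 => [|v' vv'].
  rewrite -scaler_sumr; congr (_ *: _).
  have -> : wweight d g = \sum_e scal (g ∘ bas e) *: wweight d (dbas e).
    rewrite -[LHS]/(W g) {1}(dbas_decomp (irr_simple v) g) linear_sum.
    by apply: eq_bigr => e _; rewrite linearZ.
  rewrite -[actm _ _ (\sum_e _)]/(ac _ _ _).
  rewrite (big_morph (ac _ _) (acD _ _) (ac0 _ _)) comp_sumr.
  apply: eq_bigr => e _.
  rewrite -[_ ∘ actm _ _ (bas e)]ucat_compA.
  rewrite -[actm _ _ g ∘ _]/(ac _ _ g ∘ ac _ _ (bas e)) acM.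
  rewrite {1}(scalE (irr_simple v) (g ∘ bas e)) !acZ compZr compZl compZr.
  by congr (_ *: (_ ∘ _)); rewrite /ac lm_actm_id ucat_comp1r.
apply: big1 => e _.
rewrite -[_ ∘ actm _ _ (bas e)]ucat_compA.
rewrite -[actm _ _ g ∘ _]/(ac _ _ g ∘ ac _ _ (bas e)) acM.
by rewrite (schur (g ∘ bas e) vv') ac0 comp0r comp0l scaler0.
Qed.

End TubeFacts.

(* Main.v *)
(* A label a' of the subfamily extends to a label a of the whole family by
   putting unit objects at the remaining indices, and removing these unit
   objects gives unitaries J : a (x) m -> a' (x) m, natural in m.  The embedding
   is f (x) g |-> J^* f (x) g J.  The structure maps commute with it because the
   J intertwine units, associators and commutation isomorphisms.  Three choices
   are not canonical at the removed indices and need an argument: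
   - the fusion bases of Hom(1, 1 (x) 1) produce a scalar in the left tensor
     factor of a product and its inverse in the right one; and a fusion channel
     c of two extended labels is again an extended label;
   - R_1 is a phase times the canonical isomorphism, as d_1 = 1 (read off
     from the defining relation of the quantum dimensions of M), and the
     antipode contains both this phase and its conjugate;
   - the removed actions contribute d_u / d_u = 1 to the weight in the antipode.
   The coproduct only involves the canonical tensor \sum_e e (x) e^*, which
   does not change when the basis e is replaced by J^* e. *)

From HB Require Import structures.
From mathcomp Require Import all_boot all_order all_algebra.
From mathcomp Require Import complex reals.
Require Import Defs.

Set Implicit Arguments.
Unset Strict Implicit.
Unset Printing Implicit Defensive.

Import Order.TTheory GRing.Theory Num.Theory.
Local Open Scope ring_scope.

Local Notation "g ∘ f" := (comp g f) (at level 40, left associativity).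
Local Notation "f ^†" := (dag f) (at level 2, format "f ^†").

(** * Unitary categories and actions *)

Section UnitaryCategories.

Variables (R : realType) (M : unitary_cat R).
Implicit Types x y z c : M.

Lemma unitary_id x : unitary (idm x).
Proof. by split; rewrite ucat_dag_id ucat_comp1l. Qed.

Lemma unitary_comp x y z (g : hom y z) (f : hom x y) :
  unitary g -> unitary f -> unitary (g ∘ f).
Proof.
move=> [g1 g2] [f1 f2]; split; rewrite ucat_dag_comp ucat_compA.
  by rewrite -(ucat_compA _ _ g) g1 ucat_comp1r.
by rewrite -(ucat_compA _ f) f2 ucat_comp1r.
Qed.

Lemma unitaryVl x y z (f : hom x y) (g : hom z x) (h : hom z y) :
  unitary f -> f ∘ g = h -> g = f^† ∘ h.
Proof. by move=> [f1 _] <-; rewrite ucat_compA f1 ucat_comp1l. Qed.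

Lemma unitary_cancell x y z (f : hom x y) (g h : hom z x) :
  unitary f -> f ∘ g = f ∘ h -> g = h.
Proof. by move=> uf e; rewrite (unitaryVl uf e) -(unitaryVl uf erefl). Qed.

(** An intertwining relation between unitaries passes to their adjoints. This transfers the rules
    for [wunit] and [wassoc] to the adjoints occurring in [tcoev] and [tfuse]. *)
Lemma unitary_dag_slide x y x' y' (f : hom x y) (f' : hom x' y')
    (g : hom x x') (h : hom y y') :
  unitary f -> unitary f' -> f' ∘ g = h ∘ f -> g ∘ f^† = f'^† ∘ h.
Proof.
move=> [f1 f2] [f1' f2'] e; rewrite -[g]ucat_comp1l -f1' -(ucat_compA _ f') e.
by rewrite -!ucat_compA f2 ucat_comp1r.
Qed.

(* The tensor \sum_e e (x) e^* is canonical. *)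
Lemma dual_basis_change (V : lmodType R[i]) c x y (j : hom x y)
    (B : hom c x -> hom x c -> V) :
  hdim c c = 1%N -> unitary j ->
  (forall g, linear (B^~ g)) -> (forall f, linear (B f)) ->
  \sum_e B (bas e) (dbas e) = \sum_e B (j^† ∘ bas e) (dbas e ∘ j).
Proof.
move=> c1 [j1 j2] Bl Br.
pose B1 g : {linear hom c x -> V} :=
  HB.pack (B^~ g) (GRing.isLinear.Build _ _ _ _ _ (Bl g)).
pose B2 f : {linear hom x c -> V} :=
  HB.pack (B f) (GRing.isLinear.Build _ _ _ _ _ (Br f)).
(* [P] is the matrix of [j] in the two bases. It expands [bas e] through the [j^† ∘ bas e'], and its
   transpose expands [dbas e' ∘ j] through the [dbas e], so both sides become the same double
   sum. *)
pose P (e : 'I_(hdim c x)) (e' : 'I_(hdim c y)) :=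
  coord (vbasis {: hom c y}) e' (j ∘ bas e).
have be (e : 'I_(hdim c x)) : bas e = \sum_e' P e e' *: (j^† ∘ bas e').
  rewrite -[LHS]ucat_comp1l -j1 -ucat_compA {1}(hom_decomp (j ∘ bas e)) comp_sumr.
  by apply: eq_bigr => e' _; rewrite compZr.
have de (e' : 'I_(hdim c y)) : dbas e' ∘ j = \sum_e P e e' *: dbas e.
  rewrite [LHS](dbas_decomp c1); apply: eq_bigr => e _; congr (_ *: _).
  rewrite -ucat_compA (hom_decomp (j ∘ bas e)) comp_sumr (bigD1 e') //=.
  rewrite big1 => [|e'' ne]; rewrite compZr dbas_bas //.
    by rewrite eqxx scale1r addr0 scalZ.
  by rewrite eq_sym (negPf ne) scale0r scaler0.
transitivity (\sum_e \sum_e' P e e' *: B (j^† ∘ bas e') (dbas e)).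
  apply: eq_bigr => e _; rewrite -[LHS]/(B1 (dbas e) (bas e)) {1}be linear_sum.
  by apply: eq_bigr => e' _; rewrite linearZ.
rewrite exchange_big; apply: eq_bigr => e' _.
rewrite -[RHS]/(B2 _ _) de linear_sum.
by apply: eq_bigr => e _; rewrite linearZ.
Qed.

End UnitaryCategories.

Section SemisimpleCategories.

Variables (R : realType) (M : ss_cat R).

Lemma didm_refl (i : irr M) : didm i i = idm (irrv i).
Proof. by rewrite /didm; case: eqP => // e; rewrite eq_axiomK. Qed.

Lemma didm_unitary (i j : irr M) : i = j -> unitary (didm i j).
Proof. by move=> <-; rewrite didm_refl; exact: unitary_id. Qed.

(** By Schur's lemma and duality of the bases, the sum fixes every morphism out of a simple object;
    by [irr_dec], [idm x] is a sum of morphisms factoring through simple objects. *)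
Lemma sum_bas_dbas (x : M) :
  \sum_(v : irr M) \sum_(e < hdim (irrv v) x) bas e ∘ dbas e = idm x.
Proof.
set P := LHS.
have Pf v0 (f : hom (irrv v0) x) : P ∘ f = f.
  rewrite /P comp_suml (bigD1 v0) //= [X in _ + X]big1 ?addr0 => [|v vv0]; last first.
    rewrite comp_suml big1 // => e _.
    by rewrite -ucat_compA (schur (dbas e ∘ f)) ?comp0r // eq_sym.
  rewrite comp_suml [in RHS](hom_decomp f); apply: eq_bigr => e _.
  rewrite -ucat_compA [in LHS](hom_decomp f) comp_sumr comp_sumr.
  rewrite (bigD1 e) //= [X in _ + X]big1.
    by rewrite addr0 compZr (dbas_bas (irr_simple v0)) eqxx scale1r compZr ucat_comp1r.
  move=> e' ee'; rewrite compZr (dbas_bas (irr_simple v0)) eq_sym (negPf ee').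
  by rewrite scale0r scaler0 comp0r.
have [n [l [v [_ _ vx]]]] := irr_dec x.
rewrite -[LHS]ucat_comp1r -vx comp_sumr.
by apply: eq_bigr => j _; rewrite ucat_compA Pf.
Qed.

End SemisimpleCategories.

Section Actions.

Variables (R : realType) (C : fusion_cat R) (M : unitary_cat R).
Variable A : left_module C M.

Lemma actm_comp_idl c m m' m'' (g' : hom m' m'') (g : hom m m') :
  actm A (idm c) (g' ∘ g) = actm A (idm c) g' ∘ actm A (idm c) g.
Proof. by rewrite -lm_actm_comp ucat_comp1l. Qed.

Lemma actm0r c c' m m' (f : hom c c') : actm A f (0 : hom m m') = 0.
Proof.
have := lm_actmr A f (-1) (0 : hom m m') 0.
by rewrite scaler0 addr0 scaleN1r addNr.
Qed.

Lemma actm_sumr c c' m m' (f : hom c c') I (r : seq I) (g : I -> hom m m') :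
  actm A f (\sum_(i <- r) g i) = \sum_(i <- r) actm A f (g i).
Proof.
apply: (big_morph (actm A f) _ (actm0r _ _ _)) => g1 g2.
by have := lm_actmr A f 1 g1 g2; rewrite !scale1r.
Qed.

Lemma actmZl c c' m m' a (f : hom c c') (g : hom m m') :
  actm A (a *: f) g = a *: actm A f g.
Proof.
have h0 : actm A (0 : hom c c') g = 0.
  have := lm_actml A g (-1) (0 : hom c c') 0.
  by rewrite scaler0 addr0 scaleN1r addNr.
by have := lm_actml A g a f 0; rewrite h0 !addr0.
Qed.

Lemma actmZr c c' m m' a (f : hom c c') (g : hom m m') :
  actm A f (a *: g) = a *: actm A f g.
Proof. by have := lm_actmr A f a g 0; rewrite actm0r !addr0. Qed.

Lemma actm_unitary c c' m m' (f : hom c c') (g : hom m m') :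
  unitary f -> unitary g -> unitary (actm A f g).
Proof.
by move=> [f1 f2] [g1 g2]; split; rewrite lm_actm_dag -lm_actm_comp
  ?f1 ?g1 ?f2 ?g2 lm_actm_id.
Qed.

(** Naturality turns the outer [munit] into the action of the unit object on the inner one, where
    the triangle axiom applies. Absorbing two units in turn thus agrees with merging them first. *)
Lemma munit_munit m :
  munit A m ∘ munit A (A tunit m) ∘ massoc A tunit tunit m =
  munit A m ∘ actm A (runit tunit) (idm m).
Proof. by rewrite -lm_munit_nat -ucat_compA lm_triangle. Qed.

End Actions.

(** * Invariance of the dimensions of morphism spaces under unitaries *)

Section Dimensions.

Variables (R : realType) (M : unitary_cat R).

Lemma leq_hdim (x y x' y' : M) (f : hom x x') (g : hom y y') :
  unitary f -> unitary g -> (hdim x y <= hdim x' y')%N.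
Proof.
move=> [f1 f2] [g1 g2].
have lin : linear (fun h : hom x y => g ∘ h ∘ f^†).
  by move=> a h k; rewrite ucat_compr ucat_compl.
pose L : {linear hom x y -> hom x' y'} :=
  HB.pack (fun h => g ∘ h ∘ f^†) (GRing.isLinear.Build _ _ _ _ _ lin).
have k0 : lker (linfun L) == 0%VS.
  apply/lker0P => h k; rewrite !lfunE /= => e.
  have {}e : g^† ∘ (g ∘ h ∘ f^†) ∘ f = g^† ∘ (g ∘ k ∘ f^†) ∘ f by rewrite e.
  by move: e; rewrite !ucat_compA g1 !ucat_comp1l -!ucat_compA f1 !ucat_comp1r.
rewrite /hdim -(limg_dim_eq (f := linfun L) (U := fullv)); first exact/dimvS/subvf.
by rewrite (eqP k0) capv0.
Qed.

Lemma hdim_unitary (x y x' y' : M) (f : hom x x') (g : hom y y') :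
  unitary f -> unitary g -> hdim x y = hdim x' y'.
Proof.
move=> uf ug; apply/eqP; rewrite eqn_leq (leq_hdim uf ug).
by rewrite (leq_hdim (unitary_dag uf) (unitary_dag ug)).
Qed.

Lemma hdim_eq0 (x y : M) : (forall f : hom x y, f = 0) -> hdim x y = 0%N.
Proof.
move=> h; apply/eqP; rewrite dimv_eq0 -subv0; apply/subvP => f _.
by rewrite (h f) mem0v.
Qed.

End Dimensions.

(** * The unit object of a fusion category *)

Section UnitObject.

Variables (R : realType) (F : fusion_cat R).

Lemma tunit_simple : hdim (tunit : F) tunit = 1%N.
Proof. by rewrite (hdim_unitary (fc_irr1_u F) (fc_irr1_u F)) irr_simple. Qed.

(** Defined for all [i] so that no proof of [i = irr1] has to be carried along; [didm] makes it zero
    for the other labels. *)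
Definition unit_iso (i : irr F) : hom (irrv i) (tunit : F) :=
  irr1m^† ∘ didm i irr1.

Lemma unit_iso_unitary i : i = irr1 -> unitary (unit_iso i).
Proof.
move=> e; apply: unitary_comp (didm_unitary e).
exact/unitary_dag/fc_irr1_u.
Qed.

Lemma unit_iso_neq0 i : i = irr1 -> unit_iso i != 0.
Proof.
move=> /unit_iso_unitary[h _]; apply: contra_neq (simple_id_neq0 (irr_simple i)).
by rewrite -h => ->; rewrite comp0r.
Qed.

Definition unit_iso2 (i j : irr F) : hom (tens (irrv i) (irrv j)) (tunit : F) :=
  runit tunit ∘ tensm (unit_iso i) (unit_iso j).

Lemma tensm_unitary (x x' y y' : F) (f : hom x x') (g : hom y y') :
  unitary f -> unitary g -> unitary (tensm f g).
Proof.
by move=> [f1 f2] [g1 g2]; split; rewrite fc_tensm_dag -fc_tensm_comp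
  ?f1 ?g1 ?f2 ?g2 fc_tensm_id.
Qed.

Lemma unit_iso2_unitary i j : i = irr1 -> j = irr1 -> unitary (unit_iso2 i j).
Proof.
move=> ei ej; apply: unitary_comp; first exact: fc_runit_u.
by apply: tensm_unitary; exact: unit_iso_unitary.
Qed.

Lemma tensm0r (x x' y y' : F) (f : hom x x') : tensm f (0 : hom y y') = 0.
Proof.
have := fc_tensmr f (-1) (0 : hom y y') 0.
by rewrite scaler0 addr0 scaleN1r addNr.
Qed.

(** If it vanished, the conjugate equation would make the identity of a simple object zero. *)
Lemma coevR_neq0 (i : irr F) : coevR i != 0.
Proof.
apply: contra_neq (simple_id_neq0 (irr_simple i)) => h.
by rewrite -fc_conj h tensm0r comp0r comp0l.
Qed.

(** The nonzero R_1 gives a nonzero morphism from the unit to its dual, tensoring with the unit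
    being trivial; Schur's lemma then identifies the two representatives. *)
Lemma dual_irr1 : dual irr1 = irr1 :> irr F.
Proof.
apply/eqP; rewrite eq_sym; apply: contraT => /schur h.
have [m1 m2] := fc_irr1_u F.
have [W [W1 _]] : exists W : hom (tens (irrv (dual irr1)) (irrv irr1))
    (irrv (dual irr1) : F), unitary W.
  exists (runit _ ∘ tensm (idm _) irr1m^†).
  apply: unitary_comp; first exact: fc_runit_u.
  by apply: tensm_unitary; [exact: unitary_id|exact/unitary_dag/fc_irr1_u].
have := h (W ∘ coevR irr1 ∘ irr1m^†).
move/(congr1 (fun f => W^† ∘ f ∘ irr1m)).
rewrite comp0r comp0l !ucat_compA W1 ucat_comp1l -ucat_compA m1 ucat_comp1r.
by move/eqP; rewrite (negPf (coevR_neq0 _)).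
Qed.

Section UnitFusion.

Variables (c i j : irr F).
Hypotheses (i1 : i = irr1) (j1 : j = irr1).

Local Notation fus := ('I_(hdim (irrv c) (tens (irrv i) (irrv j)))).

(** The mere existence of an index [t] gives a nonzero morphism from [irrv c] to a product
    isomorphic to the unit, so Schur's lemma applies. *)
Lemma fus_unit (t : fus) : c = irr1.
Proof.
apply/eqP/contraT => /schur h; have [m1 m2] := fc_irr1_u F.
move: (unit_iso2 i j) (unit_iso2_unitary i1 j1) => W [w1 _].
have := h (irr1m ∘ W ∘ bas t).
move/(congr1 (fun f => dbas t ∘ (W^† ∘ (irr1m^† ∘ f)))).
rewrite !comp0r -!ucat_compA (ucat_compA _ irr1m) m1 ucat_comp1l.
rewrite (ucat_compA _ W) w1 ucat_comp1l (dbas_bas (irr_simple c)).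
rewrite eqxx scale1r => /eqP.
by rewrite (negPf (simple_id_neq0 (irr_simple c))).
Qed.

(** After composition with unitaries both sides are endomorphisms of the simple unit object, hence
    scalars. Since [dbas t ∘ bas t] is the identity, the two scalars are mutually inverse. *)
Lemma fus_unit_scal (t : fus) : exists x : R[i],
  [/\ x != 0, unit_iso2 i j ∘ bas t = x *: unit_iso c
    & unit_iso c ∘ dbas t = x^-1 *: unit_iso2 i j].
Proof.
have c1 := fus_unit t.
have [u1 u2] := unit_iso_unitary c1; have [w1 w2] := unit_iso2_unitary i1 j1.
have E1 : unit_iso2 i j ∘ bas t =
    scal (unit_iso2 i j ∘ bas t ∘ (unit_iso c)^†) *: unit_iso c.
  rewrite -[LHS]ucat_comp1r -u1 ucat_compA [X in X ∘ _ = _](scalE tunit_simple).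
  by rewrite compZl ucat_comp1l.
have E2 : unit_iso c ∘ dbas t =
    scal (unit_iso c ∘ dbas t ∘ (unit_iso2 i j)^†) *: unit_iso2 i j.
  rewrite -[LHS]ucat_comp1r -w1 ucat_compA [X in X ∘ _ = _](scalE tunit_simple).
  by rewrite compZl ucat_comp1l.
move: E1 E2; set x := scal _; set y := scal _ => E1 E2.
have yx : y * x = 1.
  have : unit_iso c ∘ dbas t ∘ bas t = (y * x) *: unit_iso c.
    by rewrite E2 compZl E1 scalerA.
  rewrite -ucat_compA (dbas_bas (irr_simple c)) eqxx scale1r ucat_comp1r.
  move/eqP; rewrite -{1}[unit_iso c]scale1r -subr_eq0 -scalerBl scaler_eq0.
  by rewrite (negPf (unit_iso_neq0 c1)) orbF subr_eq0 eq_sym => /eqP.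
have x0 : x != 0 by apply: contra_eq_neq yx => ->; rewrite mulr0 eq_sym oner_eq0.
exists x; split=> //; rewrite E2; congr (_ *: _).
by rewrite -[LHS]mulr1 -(divff x0) mulrA yx mul1r.
Qed.

(** Distinct indices would pair to zero, but [dbas t] and [bas t'] are nonzero multiples of mutually
    inverse isomorphisms, up to the units. *)
Lemma fus_unit_uniq (t t' : fus) : t = t'.
Proof.
have c1 := fus_unit t.
have [x [x0 _ E1]] := fus_unit_scal t; have [y [y0 E2 _]] := fus_unit_scal t'.
apply/eqP/contraT => tt'.
have : unit_iso c ∘ (dbas t ∘ bas t') = 0.
  by rewrite (dbas_bas (irr_simple c)) (negPf tt') scale0r comp0r.
move/eqP; rewrite ucat_compA E1 compZl E2 scalerA scaler_eq0 mulf_eq0 invr_eq0.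
by rewrite (negPf x0) (negPf y0) (negPf (unit_iso_neq0 c1)).
Qed.

(** The canonical isomorphism is nonzero, so its expansion in the basis cannot be an empty sum. *)
Lemma fus_unit_ex : c = irr1 -> exists t : fus, true.
Proof.
move=> c1; have [w1 w2] := unit_iso2_unitary i1 j1.
have [u1 u2] := unit_iso_unitary c1.
case n0 : (hdim (irrv c) (tens (irrv i) (irrv j))) => [|n]; last by exists ord0.
have := hom_decomp ((unit_iso2 i j)^† ∘ unit_iso c).
rewrite big1; last by move=> t _; have := ltn_ord t; rewrite [X in (_ < X)%N]n0.
move/(congr1 (fun f => unit_iso2 i j ∘ f)).
by rewrite ucat_compA w2 ucat_comp1l comp0r => /eqP; rewrite (negPf (unit_iso_neq0 c1)).
Qed.

End UnitFusion.

(** The composite is an endomorphism of the unit, hence a scalar. All factors other than [coevR i]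
    are unitary, so its squared modulus is R_1^† R_1 = d_1 = 1. *)
Lemma coevR_unit_scal (i l : irr F) : i = irr1 -> l = dual i ->
  qdimc (irr1 : irr F) = 1 -> exists2 x : R[i], x * x^* = 1 &
  unit_iso2 l i ∘ (tensm (didm (dual i) l) (idm (irrv i)) ∘ coevR i) =
    x *: idm tunit.
Proof.
move=> i1 li d1; have l1 : l = irr1 by rewrite li i1 dual_irr1.
move: (unit_iso2 l i) (unit_iso2_unitary l1 i1) => W [w1 w2].
have [t1 t2] : unitary (tensm (didm (dual i) l) (idm (irrv i))).
  exact: tensm_unitary (didm_unitary (esym li)) (unitary_id _).
set f := _ ∘ _; exists (scal f); last by rewrite -(scalE tunit_simple).
have : f^† ∘ f = idm tunit.
  rewrite !ucat_dag_comp -!ucat_compA (ucat_compA _ W) w1 ucat_comp1l.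
  by rewrite (ucat_compA _ (tensm _ _)) t1 ucat_comp1l fc_qdim i1 d1 scale1r.
rewrite (scalE tunit_simple f) dagZ compZl compZr ucat_dag_id ucat_comp1l scalerA.
move/(congr1 (@scal R F tunit)); rewrite (scalZ tunit_simple) mulrC.
rewrite -(scalE tunit_simple) => ->.
by rewrite -[idm _]scale1r (scalZ tunit_simple).
Qed.

End UnitObject.

(** The unit acts trivially up to a unitary, so only [n = m] contributes to the sum, with
    multiplicity one; then the positive [d m] is cancelled. *)
Lemma qdimc_irr1 (R : realType) (F : fusion_cat R) (M : ss_cat R)
    (A : left_module F M) (d : irr M -> R) (m : irr M) :
  (forall n, 0 < d n) ->
  (qdimc (irr1 : irr F) * d m =
   \sum_n (hdim (A (irrv (irr1 : irr F)) (irrv m) : M) (irrv n))%:R * d n) ->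
  qdimc (irr1 : irr F) = 1.
Proof.
move=> d0 dE; apply: (mulIf (lt0r_neq0 (d0 m))).
have u : unitary (munit A (irrv m) ∘ actm A irr1m^† (idm (irrv m))).
  apply: unitary_comp; first exact: lm_munit_u.
  exact: actm_unitary (unitary_dag (fc_irr1_u F)) (unitary_id _).
rewrite mul1r dE (bigD1 m) //= (hdim_unitary u (unitary_id _)) irr_simple mul1r.
rewrite big1 ?addr0 // => n nm.
rewrite (hdim_unitary u (unitary_id _)) hdim_eq0 ?mul0r // => f.
by apply: schur; rewrite eq_sym.
Qed.

(** [r] is the converse of the graph of an injection from [T'] to [T], and [G] vanishes off its
    image. This compares sums over labels and fusion indices of the whole family with those of the
    subfamily. *)
Lemma big_functional_rel (V : nmodType) (T T' : finType) (r : T -> T' -> Prop)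
    (G : T -> V) (G' : T' -> V) :
  (forall t', exists t, r t t') ->
  (forall t, (exists t', r t t') \/ G t = 0) ->
  (forall t s t', r t t' -> r s t' -> t = s) ->
  (forall t t' s', r t t' -> r t s' -> t' = s') ->
  (forall t t', r t t' -> G t = G' t') ->
  \sum_t G t = \sum_t' G' t'.
Proof.
move=> /fin_all_exists[f rf] r0 r_injl r_injr rG.
have f_inj : injective f by move=> x y e; apply: r_injr (rf x) _; rewrite e.
rewrite (bigID [in f @: [set: T']]) /= [X in _ + X]big1 ?addr0 => [|t nt].
  rewrite big_imset => [|x y _ _ /f_inj //].
  by apply: eq_big => [t'|t' _]; [rewrite inE|exact: rG].
have [[t' tt']|//] := r0 t; case/negP: nt; apply/imsetP.
by exists t'; rewrite ?inE //; exact: r_injl tt' (rf t').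
Qed.

(** * Transport along equalities of simple objects *)

Section Didm.

Variables (R : realType) (F : fusion_cat R).
Implicit Types a b c : irr F.

(** The labels are only propositionally equal, so the bases are compared through [didm]; after
    substitution every [didm] is an identity. *)
Lemma bas_didm c c' a a' b b'
    (t : 'I_(hdim (irrv c) (tens (irrv a) (irrv b))))
    (t' : 'I_(hdim (irrv c') (tens (irrv a') (irrv b')))) :
  c = c' -> a = a' -> b = b' -> t = t' :> nat ->
  tensm (didm a a') (didm b b') ∘ bas t = bas t' ∘ didm c c'.
Proof.
move=> ec ea eb; subst; move=> /val_inj->.
by rewrite !didm_refl fc_tensm_id ucat_comp1l ucat_comp1r.
Qed.

Lemma dbas_didm c c' a a' b b'
    (t : 'I_(hdim (irrv c) (tens (irrv a) (irrv b))))
    (t' : 'I_(hdim (irrv c') (tens (irrv a') (irrv b')))) :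
  c = c' -> a = a' -> b = b' -> t = t' :> nat ->
  didm c c' ∘ dbas t = dbas t' ∘ tensm (didm a a') (didm b b').
Proof.
move=> ec ea eb; subst; move=> /val_inj->.
by rewrite !didm_refl fc_tensm_id ucat_comp1l ucat_comp1r.
Qed.

Lemma coevR_didm a a' b b' : a = a' -> b = dual a -> b' = dual a' ->
  tensm (didm b b') (didm a a') ∘
    (tensm (didm (dual a) b) (idm (irrv a)) ∘ coevR a) =
  tensm (didm (dual a') b') (idm (irrv a')) ∘ coevR a'.
Proof.
move=> ea eb eb'; subst; rewrite !didm_refl fc_tensm_id !ucat_comp1l.
by [].
Qed.

Lemma unit_iso_didm a b : a = b -> unit_iso b ∘ didm a b = unit_iso a.
Proof. by move=> ->; rewrite didm_refl ucat_comp1r. Qed.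

End Didm.

(** * Iterated actions *)

Section Words.

Variables (R : realType) (p q : nat) (C : 'I_p -> fusion_cat R).
Variables (D : 'I_q -> fusion_cat R) (M : multimodule C D).

Notation K := ('I_p + 'I_q)%type.
Notation F := (actor C D).
Notation A := (mm_act M).
Notation objs := (forall k : K, F k).

Implicit Types (s : seq K) (a b c : objs) (m n r : M).

Lemma wactm_comp s a b c (f : forall k, hom (b k) (c k))
    (g : forall k, hom (a k) (b k)) m n r (h : hom n r) (l : hom m n) :
  wactm s f h ∘ wactm s g l = wactm s (fun k => f k ∘ g k) (h ∘ l).
Proof. by elim: s => //= k s IH; rewrite -lm_actm_comp IH. Qed.

Lemma eq_wactm s a b (f g : forall k, hom (a k) (b k)) m n (h : hom m n) :
  (forall k, f k = g k) -> wactm s f h = wactm s g h.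
Proof. by move=> fg; elim: s => //= k s ->; rewrite fg. Qed.

Lemma wactm_id s a m : wactm s (fun k => idm (a k)) (idm m) = idm (wact s a m).
Proof. by elim: s => //= k s ->; rewrite lm_actm_id. Qed.

Lemma wactm_comp_idl s a m n r (h : hom n r) (l : hom m n) :
  wactm s (fun k => idm (a k)) (h ∘ l) =
  wactm s (fun k => idm (a k)) h ∘ wactm s (fun k => idm (a k)) l.
Proof. by rewrite wactm_comp; apply: eq_wactm => k; rewrite ucat_comp1l. Qed.

Lemma wactm_dag s a b (f : forall k, hom (a k) (b k)) m n (h : hom m n) :
  (wactm s f h)^† = wactm s (fun k => (f k)^†) h^†.
Proof. by elim: s => //= k s IH; rewrite lm_actm_dag IH. Qed.

Lemma wactm_linear s a m n : linear (@wactm R p q C D M s a a (fun k => idm (a k)) m n).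
Proof. by elim: s => //= k s IH x f g; rewrite IH lm_actmr. Qed.

Lemma wunit_unitary s m : unitary (wunit s m).
Proof.
elim: s => [|k s IH] /=; first exact: unitary_id.
by apply: unitary_comp IH _; exact: lm_munit_u.
Qed.

Lemma comm_unitary (k l : K) (c : F k) (d : F l) m : k != l -> unitary (mm_comm M k l c d m).
Proof. by move=> kl; exact: (comm_u (mm_coh M kl)). Qed.

(** This is [comm_unit] with the two actions exchanged, composed with the inverse commutation
    isomorphism. *)
Lemma comm_munit (k l : K) (c : F k) m : k != l ->
  munit (A l) (A k c m) ∘ mm_comm M k l c tunit m =
  actm (A k) (idm c) (munit (A l) m).
Proof.
move=> kl; have lk : l != k by rewrite eq_sym.
rewrite -(comm_unit (mm_coh M lk)) -ucat_compA.
by rewrite (comm_inv (mm_coh M kl)) ucat_comp1r.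
Qed.

Lemma wpush_nat s k (c c' : F k) a b (f : hom c c')
    (h : forall l, hom (a l) (b l)) m n (g : hom m n) : k \notin s ->
  wpush s c' b n ∘ actm (A k) f (wactm s h g) =
  wactm s h (actm (A k) f g) ∘ wpush s c a m.
Proof.
elim: s => [|l s IH] /=; first by rewrite ucat_comp1l ucat_comp1r.
rewrite inE negb_or => /andP[kl /IH{}IH].
rewrite -ucat_compA (comm_nat (mm_coh M kl)) !ucat_compA; congr (_ ∘ _).
by rewrite -!lm_actm_comp IH ucat_comp1l ucat_comp1r.
Qed.

Lemma wpush_unitary s k (c : F k) a m : k \notin s -> unitary (wpush s c a m).
Proof.
elim: s => [|l s IH] /=; first by move=> _; exact: unitary_id.
rewrite inE negb_or => /andP[kl /IH{}IH]; apply: unitary_comp.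
  exact: actm_unitary (unitary_id _) IH.
exact: comm_unitary.
Qed.

Lemma wpush_munit s k a m : k \notin s ->
  wactm s (fun l => idm (a l)) (munit (A k) m) ∘ wpush s tunit a m =
  munit (A k) (wact s a m).
Proof.
elim: s => [|l s IH] /=; first by rewrite ucat_comp1r.
rewrite inE negb_or => /andP[kl /IH{}IH].
by rewrite ucat_compA -actm_comp_idl IH (comm_unit (mm_coh M kl)).
Qed.

Lemma wassoc_unitary s a b m : uniq s -> unitary (wassoc s a b m).
Proof.
elim: s => [|k s IH] /=; first by move=> _; exact: unitary_id.
move=> /andP[ks /IH{}IH]; apply: unitary_comp.
  apply: unitary_comp (lm_massoc_u _ _ _ _).
  exact: actm_unitary (unitary_id _) (wpush_unitary _ _ _ ks).
exact: actm_unitary (unitary_id _) IH.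
Qed.

Lemma wweight_sum (d : qdims M) s a u w I (r : seq I)
    (f : I -> hom (wact s a (irrv u)) (irrv w)) :
  wweight d (\sum_(i <- r) f i) = \sum_(i <- r) wweight d (f i).
Proof.
have lin := @wweight_linear R p q C D M d s a u w.
have wD : {morph @wweight R p q C D M d s a u w : g h / g + h}.
  by move=> g h; have := lin 1 g h; rewrite !scale1r.
have w0 : @wweight R p q C D M d s a u w 0 = 0.
  by have := lin (-1) 0 0; rewrite scaler0 addr0 scaleN1r addNr.
exact: (big_morph _ wD w0).
Qed.

End Words.

(** * Linearity of the tube algebra operations *)

Section LinearMaps.

Variable K : nzRingType.
Implicit Types V W : lmodType K.

Lemma linear0_of V W (f : V -> W) : linear f -> f 0 = 0.
Proof. by move=> lf; have := lf (-1) 0 0; rewrite scaler0 addr0 scaleN1r addNr. Qed.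

Lemma linearZ_of V W (f : V -> W) a x : linear f -> f (a *: x) = a *: f x.
Proof. by move=> lf; have := lf a x 0; rewrite (linear0_of lf) !addr0. Qed.

Lemma linear_sum_of V W (f : V -> W) I (r : seq I) (P : pred I) (F : I -> V) :
  linear f -> f (\sum_(i <- r | P i) F i) = \sum_(i <- r | P i) f (F i).
Proof.
move=> lf; have fD : {morph f : x y / x + y}.
  by move=> x y; have := lf 1 x y; rewrite !scale1r.
exact: (big_morph f fD (linear0_of lf)).
Qed.

Lemma linear_comp V W (U : lmodType K) (f : V -> W) (g : W -> U) :
  linear f -> linear g -> linear (fun x => g (f x)).
Proof. by move=> lf lg a x y; rewrite lf lg. Qed.

Lemma linear_sum_fun V W I (r : seq I) (P : pred I) (f : I -> V -> W) :
  (forall i, linear (f i)) -> linear (fun x => \sum_(i <- r | P i) f i x).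
Proof.
move=> lf a x y; rewrite scaler_sumr -big_split.
by apply: eq_bigr => i _; exact: lf.
Qed.

End LinearMaps.

Lemma coordP_of (K : fieldType) (V : vectType K) n (X : n.-tuple V) i k f f' :
  coord X i (k *: f + f') = k * coord X i f + coord X i f'.
Proof. exact: linearP. Qed.

(** * The tensor square of a based space *)

Section TensorSquare.

Variable R : realType.

Lemma vtens_linear_l (B B' : finType) (Y : vec R B') :
  linear (fun X : vec R B => vtens X Y).
Proof.
by move=> a X X'; apply/ffunP => b; rewrite !ffunE mulrDl; congr (_ + _); rewrite -mulrA.
Qed.

Lemma vtens_linear_r (B B' : finType) (X : vec R B) :
  linear (fun Y : vec R B' => vtens X Y).
Proof.
by move=> a Y Y'; apply/ffunP => b; rewrite !ffunE mulrDr; congr (_ + _); exact: mulrCA.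
Qed.

Lemma vec_evec (B : finType) (X : vec R B) : X = \sum_b X b *: evec R b.
Proof.
apply/ffunP => b; rewrite sum_ffunE (bigD1 b) //= big1 ?addr0 => [|b' nb].
  by rewrite !ffunE eqxx [RHS]mulr1.
by rewrite !ffunE eq_sym (negPf nb) [LHS]mulr0.
Qed.

Lemma vtens_map_linear (B B' : finType) (phi : vec R B -> vec R B') :
  linear (vtens_map phi).
Proof.
move=> a X Y; rewrite /vtens_map scaler_sumr -big_split; apply: eq_bigr => b _.
by rewrite !ffunE scalerDl scalerA.
Qed.

Lemma vtens_map_vtens (B B' : finType) (phi : vec R B -> vec R B')
    (X Y : vec R B) :
  linear phi -> vtens_map phi (vtens X Y) = vtens (phi X) (phi Y).
Proof.
move=> lphi; rewrite [in RHS](vec_evec X) (linear_sum_of _ _ _ lphi).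
rewrite (linear_sum_of _ _ _ (vtens_linear_l _)).
transitivity (\sum_b \sum_b'
  vtens X Y (b, b') *: vtens (phi (evec R b)) (phi (evec R b'))).
  by rewrite pair_bigA; apply: eq_bigr => -[b b'].
apply: eq_bigr => b _.
rewrite (linearZ_of _ _ lphi) (linearZ_of _ _ (vtens_linear_l _)).
rewrite [in RHS](vec_evec Y) (linear_sum_of _ _ _ lphi).
rewrite (linear_sum_of _ _ _ (vtens_linear_r _)) scaler_sumr.
apply: eq_bigr => b' _; rewrite (linearZ_of _ _ lphi).
by rewrite (linearZ_of _ _ (vtens_linear_r _)) scalerA ffunE.
Qed.

End TensorSquare.

(** * The structure maps on pure tensors *)

Section Tubes.

Variables (R : realType) (p q : nat) (C : 'I_p -> fusion_cat R).
Variables (D : 'I_q -> fusion_cat R) (M : multimodule C D) (d : qdims M).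
Implicit Types (a b c : label C D) (x z u w : irr M).

Lemma pure_linear_l a x z u w (g : hom2 a u w) :
  linear (fun f : hom1 a x z => pure f g).
Proof.
move=> k f f'; rewrite /pure scaler_sumr -big_split; apply: eq_bigr => i _.
rewrite scaler_sumr -big_split; apply: eq_bigr => j _ /=.
by rewrite coordP_of mulrDl scalerDl -mulrA -scalerA.
Qed.

Lemma pure_linear_r a x z u w (f : hom1 a x z) :
  linear (fun g : hom2 a u w => pure f g).
Proof.
move=> k g g'; rewrite /pure scaler_sumr -big_split; apply: eq_bigr => i _.
rewrite scaler_sumr -big_split; apply: eq_bigr => j _ /=.
by rewrite coordP_of mulrDr scalerDl mulrCA scalerA.
Qed.

Lemma pureZ a x z u w (f : hom1 a x z) (g : hom2 a u w) (k l : R[i]) :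
  pure (k *: f) (l *: g) = (k * l) *: pure f g.
Proof.
rewrite (linearZ_of _ _ (pure_linear_l _)) (linearZ_of _ _ (pure_linear_r _)).
by rewrite scalerA.
Qed.

Lemma ext_linear (V : lmodType R[i])
    (phi : forall a x z u w, hom1 a x z -> hom2 a u w -> V) :
  linear (ext phi).
Proof.
move=> k X Y; rewrite /ext scaler_sumr -big_split /=.
by apply: eq_bigr => b _; rewrite !ffunE scalerDl scalerA.
Qed.

(** Every basis vector [evec] is the pure tensor of two basis morphisms, so pure tensors span. Each
    compatibility of the embedding is reduced to pure tensors in this way. *)
Lemma eq_on_pure (V : lmodType R[i]) (f g : vec R (tbasis M) -> V) :
  linear f -> linear g ->
  (forall a x z u w (h : hom1 a x z) (k : hom2 a u w),
     f (pure h k) = g (pure h k)) ->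
  f =1 g.
Proof.
move=> lf lg fg X; rewrite (vec_evec X) (linear_sum_of _ _ _ lf).
rewrite (linear_sum_of _ _ _ lg); apply: eq_bigr => b _.
rewrite (linearZ_of _ _ lf) (linearZ_of _ _ lg); congr (_ *: _).
case: b => -[[a [x z]] [u w]] [i j].
suff -> : evec R (Tagged (fun t : tidx M => ('I_(tdim1 t) * 'I_(tdim2 t))%type)
    (i, j)) = pure (vbasis {: hom1 a x z})`_i (vbasis {: hom2 a u w})`_j by [].
have fr1 : free (vbasis {: hom1 a x z}) := basis_free (vbasisP _).
have fr2 : free (vbasis {: hom2 a u w}) := basis_free (vbasisP _).
rewrite /pure (bigD1 i) //= [X in _ + X]big1 ?addr0 => [|i' ne].
  rewrite (bigD1 j) //= big1 ?addr0 => [|j' ne].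
    by rewrite !coord_free // !eqxx mulr1 scale1r.
  by rewrite (coord_free _ _ fr2) eq_sym (negPf ne) mulr0 scale0r.
rewrite big1 // => j' _.
by rewrite (coord_free _ _ fr1) eq_sym (negPf ne) mul0r scale0r.
Qed.

Lemma ext_linear_fun (U V : lmodType R[i])
    (phi : U -> forall a x z u w, hom1 a x z -> hom2 a u w -> V) X :
  (forall a x z u w (h : hom1 a x z) (k : hom2 a u w),
     linear (fun t => phi t a x z u w h k)) ->
  linear (fun t => ext (phi t) X).
Proof.
move=> lphi; apply: linear_sum_fun => b l s t.
by rewrite lphi scalerDr !scalerA mulrC.
Qed.

Lemma tmul_linear_l (Y : vec R (tbasis M)) : linear (fun X => tmul X Y).
Proof. exact: ext_linear. Qed.

Lemma tmul_linear_r (X : vec R (tbasis M)) : linear (tmul X).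
Proof.
apply: linear_sum_fun => b k Y Y'.
by rewrite ext_linear scalerDr !scalerA mulrC.
Qed.

(** [ext_pure] is applied once per factor; the work lies in checking linearity in each of the four
    morphisms. *)
Lemma tmul_pure a x z u w (f : hom1 a x z) (g : hom2 a u w)
    b x' z' u' w' (f' : hom1 b x' z') (g' : hom2 b u' w') :
  tmul (pure f g) (pure f' g') =
  \sum_(c : label C D) \sum_(t : fus c a b)
    pure (tfuse t (irrv z') ∘ tactm a (f' ∘ didm z x') ∘ f : hom1 c x z')
         (g ∘ tactm a (didm w' u ∘ g') ∘ tsplit t (irrv u') : hom2 c u' w).
Proof.
rewrite /tmul ext_pure => [|{}g|{}f]; first 1 last.
- apply: ext_linear_fun => ? ? ? ? ? h k; apply: linear_sum_fun => c.
  by apply: linear_sum_fun => t l s s'; rewrite ucat_compr pure_linear_l.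
- apply: ext_linear_fun => ? ? ? ? ? h k; apply: linear_sum_fun => c.
  by apply: linear_sum_fun => t l s s'; rewrite !ucat_compl pure_linear_r.
rewrite ext_pure // => [{}g'|{}f'].
  apply: linear_sum_fun => c; apply: linear_sum_fun => t l s s'.
  by rewrite ucat_compl /tactm wactm_linear ucat_compr ucat_compl pure_linear_l.
apply: linear_sum_fun => c; apply: linear_sum_fun => t l s s'.
by rewrite ucat_compr /tactm wactm_linear ucat_compr ucat_compl pure_linear_r.
Qed.

Lemma tcomul_linear : linear (@tcomul R p q C D M).
Proof. exact: ext_linear. Qed.

Lemma tcomul_pure a x z u w (f : hom1 a x z) (g : hom2 a u w) :
  tcomul (pure f g) =
  \sum_(s : irr M) \sum_(t : irr M) \sum_(e < hdim (irrv t) (tact a (irrv s)))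
    vtens (pure (bas e : hom1 a t s) g) (pure f (dbas e : hom2 a s t)).
Proof.
rewrite /tcomul ext_pure // => [{}g|{}f].
  do 3![apply: linear_sum_fun => ?] => l h h'.
  by rewrite pure_linear_l vtens_linear_r.
do 3![apply: linear_sum_fun => ?] => l h h'.
by rewrite pure_linear_r vtens_linear_l.
Qed.

Lemma scal_linear (x : M) : linear (@scal R M x : _ -> R[i]^o).
Proof. by move=> k f g; rewrite /scal linearP. Qed.

Lemma tcounit_linear : linear (@tcounit R p q C D M).
Proof. exact: ext_linear. Qed.

Lemma tcounit_pure a x z u w (f : hom1 a x z) (g : hom2 a u w) :
  tcounit (pure f g) = scal (didm w x ∘ g ∘ tactm a (didm z u) ∘ f).
Proof.
rewrite /tcounit ext_pure // => [{}g|{}f] l h h'.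
  by rewrite ucat_compr scal_linear.
by rewrite ucat_compr !ucat_compl scal_linear.
Qed.

Lemma tantip_linear : linear (tantip d).
Proof. exact: ext_linear. Qed.

Lemma tantip_pure a x z u w (f : hom1 a x z) (g : hom2 a u w) :
  tantip d (pure f g) = pure (ghat (wweight d g : hom2 a u w)) (fhat f).
Proof.
rewrite /tantip ext_pure // => [{}g|{}f] l h h'.
  by rewrite /fhat /tactm wactm_linear ucat_compr pure_linear_r.
by rewrite wweight_linear /ghat /tactm wactm_linear ucat_compl pure_linear_l.
Qed.

(** Lets the rule for [fhat] in the antipode be read off from that for [ghat] by taking adjoints. *)
Lemma ghat_dag a z x (f : hom1 a x z) : (ghat (f^† : hom2 a z x))^† = fhat f.
Proof.
rewrite /ghat /fhat ucat_dag_comp /tactm wactm_dag ucat_dagK; congr (_ ∘ _).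
by apply: eq_wactm => k; rewrite ucat_dag_id.
Qed.

End Tubes.

(** * Removing unit objects from an iterated action *)

Section Restriction.

Variables (R : realType) (p q : nat) (C : 'I_p -> fusion_cat R).
Variables (D : 'I_q -> fusion_cat R) (M : multimodule C D).
Variables (I' : {set 'I_p}) (J' : {set 'I_q}).

Let M' := mm_restrict M I' J'.

Notation K := ('I_p + 'I_q)%type.
Notation K' := ('I_#|I'| + 'I_#|J'|)%type.
Notation F := (actor C D).
Notation F' := (actor (subfam (S := I') C) (subfam (S := J') D)).
Notation A := (mm_act M).
Notation A' := (mm_act M').
Notation ix := (@subidx p q I' J').
Notation objs := (forall k : K, F k).
Notation objs' := (forall k : K', F' k).

(* Composition in M even when the terms mention M', whose category is only
   convertible to that of M. *)
Local Notation "g ⊚ f" := (@comp R M _ _ _ g f)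
  (at level 40, left associativity, only parsing).

Definition kept (k : K) : bool :=
  match k with inl i => i \in I' | inr j => j \in J' end.

Lemma kept_subidx k' : kept (ix k').
Proof. by case: k' => i; exact: enum_valP. Qed.

Lemma keptP k : kept k -> exists k', ix k' = k.
Proof.
case: k => i; rewrite /kept => ki.
  by exists (inl (enum_rank_in ki i)); rewrite /= enum_rankK_in.
by exists (inr (enum_rank_in ki i)); rewrite /= enum_rankK_in.
Qed.

(* F' k' and F (ix k') only become convertible once k' is a constructor; the
   following operations hide this case distinction. *)
Definition khom (k' : K') : F (ix k') -> F' k' -> vectType R[i] :=
  match k' with
  | inl i => fun c c' : C (enum_val i) => hom c c'
  | inr j => fun c c' : mop (D (enum_val j)) => hom c c'
  end.

Definition kcompr (k' : K') :
    forall c c1 c', @khom k' c1 c' -> hom c c1 -> @khom k' c c' :=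
  match k' with
  | inl i => fun c c1 c' f h => f ∘ h
  | inr j => fun c c1 c' f h => f ∘ h
  end.

Definition kcompl (k' : K') :
    forall c c1' c', hom c1' c' -> @khom k' c c1' -> @khom k' c c' :=
  match k' with
  | inl i => fun c c1' c' h f => h ∘ f
  | inr j => fun c c1' c' h f => h ∘ f
  end.

Definition ktens (k' : K') : forall c1 c1' c2 c2',
    @khom k' c1 c1' -> @khom k' c2 c2' -> @khom k' (tens c1 c2) (tens c1' c2') :=
  match k' with
  | inl i => fun c1 c1' c2 c2' f g => tensm f g
  | inr j => fun c1 c1' c2 c2' f g => tensm f g
  end.

Definition kunit (k' : K') : @khom k' tunit tunit :=
  match k' with inl i => idm tunit | inr j => idm tunit end.

Definition kunitary (k' : K') : forall c c', @khom k' c c' -> Prop :=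
  match k' with
  | inl i => fun c c' f => unitary f
  | inr j => fun c c' f => unitary f
  end.

Definition kact (k' : K') : forall (c : F (ix k')) (c' : F' k') (m n : M),
    @khom k' c c' -> hom m n -> hom (A (ix k') c m : M) (A' k' c' n) :=
  match k' with
  | inl i => fun c c' m n f g => actm (A (inl (enum_val i))) f g
  | inr j => fun c c' m n f g => actm (A (inr (enum_val j))) f g
  end.

Lemma kact_compr k' (c c1 : F (ix k')) c' (m n r : M) (f : @khom k' c1 c')
    (h : hom c c1) (g : hom n r) (l : hom m n) :
  kact f g ∘ actm (A (ix k')) h l = kact (kcompr f h) (g ∘ l).
Proof. by case: k' c c1 c' f h => i c c1 c' f h; rewrite /= lm_actm_comp. Qed.

Lemma kact_compl k' c (c1 c' : F' k') (m n r : M) (f : @khom k' c c1)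
    (h : hom c1 c') (g : hom m n) (l : hom n r) :
  actm (A' k') h l ⊚ kact f g = kact (kcompl h f) (l ∘ g).
Proof. by case: k' c c1 c' f h => i c c1 c' f h; rewrite /= lm_actm_comp. Qed.

Lemma kcompl_id k' c c' (f : @khom k' c c') : kcompl (idm c') f = f.
Proof. by case: k' c c' f => i c c' f; exact: ucat_comp1l. Qed.

Lemma kcompr_id k' c c' (f : @khom k' c c') : kcompr f (idm c) = f.
Proof. by case: k' c c' f => i c c' f; exact: ucat_comp1r. Qed.

Lemma kact_massoc k' c1 c1' c2 c2' (m n : M) (f1 : @khom k' c1 c1')
    (f2 : @khom k' c2 c2') (g : hom m n) :
  massoc (A' k') c1' c2' n ⊚ kact (ktens f1 f2) g =
  kact f1 (kact f2 g) ∘ massoc (A (ix k')) c1 c2 m.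
Proof.
by case: k' c1 c1' c2 c2' f1 f2 => i c1 c1' c2 c2' f1 f2; exact: lm_massoc_nat.
Qed.

Lemma kact_munit k' (m n : M) (g : hom m n) :
  munit (A' k') n ⊚ kact (kunit k') g = g ∘ munit (A (ix k')) m.
Proof. by case: k' => i; exact: lm_munit_nat. Qed.

Lemma kact_comm k' l' c c' e e' (m n : M) (f : @khom k' c c')
    (h : @khom l' e e') (g : hom m n) : k' != l' ->
  mm_comm M' k' l' c' e' n ⊚ kact f (kact h g) =
  kact h (kact f g) ∘ mm_comm M (ix k') (ix l') c e m.
Proof.
rewrite -(inj_eq (@subidx_inj p q I' J')).
by case: k' c c' f => i c c' f; case: l' e e' h => j e e' h kl;
   exact: (comm_nat (mm_coh M kl)).
Qed.

Lemma kact_unitary k' c c' (m n : M) (f : @khom k' c c') (g : hom m n) :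
  kunitary f -> unitary g -> unitary (kact f g).
Proof. by case: k' c c' f => i c c' f; exact: actm_unitary. Qed.

(* s' is s with the indices outside of the subfamily deleted.  This lives in
   Type because the morphisms wred below are defined by recursion on it. *)
Inductive emb : seq K' -> seq K -> Type :=
| EmbNil : emb [::] [::]
| EmbKeep k' s' s of emb s' s : emb (k' :: s') (ix k' :: s)
| EmbDrop k s' s of ~~ kept k & emb s' s : emb s' (k :: s).

(** * The word of the subfamily inside the word of the whole family *)

Lemma emb_filter (s' : seq K') (s : seq K) :
  map ix s' = filter kept s -> emb s' s.
Proof.
elim: s s' => [|k s IH] [|k' s'] //=; first by move=> _; exact: EmbNil.
  by case: ifP => // /negbT nk e; apply: EmbDrop nk (IH [::] e).
case: ifP => [_ [<- e]|/negbT nk e]; first exact: EmbKeep (IH _ e).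
exact: EmbDrop nk (IH (_ :: _) e).
Qed.

Lemma filter_enum_val n (S : {set 'I_n}) :
  [seq enum_val i | i <- enum 'I_#|S|] = [seq i <- enum 'I_n | i \in S].
Proof.
rewrite [X in filter _ X]enumT -[RHS]/(enum S).
(* The comparison by [nth] needs a default element of ['I_n]; for n = 0 both lists are empty. *)
case: n S => [|n] S; first by case: (map _ _) => [|[]//]; case: (enum S) => [|[]//].
apply: (@eq_from_nth _ ord0) => [|i]; rewrite size_map size_enum_ord -?cardE // => iS.
rewrite (nth_map (Ordinal iS)) ?size_enum_ord // (enum_val_nth ord0).
by rewrite nth_enum_ord.
Qed.

(** Holds because [enum_val] enumerates each subset in increasing order, so that filtering the full
    word keeps the order of actions used for the subfamily. *)
Lemma emb_word : emb (word #|I'| #|J'|) (word p q).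
Proof.
have fl : [seq k <- [seq inl i | i <- enum 'I_p] | kept k] =
          [seq ix (inl i) | i <- enum 'I_#|I'|].
  by rewrite filter_map -(filter_enum_val I') -map_comp.
have fr : [seq k <- [seq inr j | j <- enum 'I_q] | kept k] =
          [seq ix (inr j) | j <- enum 'I_#|J'|].
  by rewrite filter_map -(filter_enum_val J') -map_comp.
apply: emb_filter; rewrite /word map_rev filter_rev map_cat filter_cat fl fr.
by rewrite -!map_comp.
Qed.

Lemma word_uniq n r : uniq (word n r).
Proof.
have hd : ~~ has [in map inl (enum 'I_n)] (map inr (enum 'I_r)) :> bool.
  by apply/hasPn => x /mapP[j _ ->]; apply/mapP => -[].
rewrite rev_uniq cat_uniq (negPf hd) !map_inj_uniq; try by move=> i j [].
by rewrite -!enumT !enum_uniq.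
Qed.

Section WordReduction.

Variables (a : objs) (a' : objs').
Variables (v : forall k', khom (a (ix k')) (a' k')) (u : forall k, hom (a k) tunit).

(* a_k is sent to a'_k by v at the kept indices and to the unit object, which is
   then absorbed by munit, by u at the deleted ones. *)
Fixpoint wred s' s (e : emb s' s) (m n : M) (g : hom m n) :
    hom (wact s a m : M) (wact (M := M') s' a' n : M) :=
  match e in emb s' s
    return hom (wact s a m : M) (wact (M := M') s' a' n : M) with
  | EmbNil => g
  | EmbKeep k' s' s e => kact (v k') (wred e g)
  | EmbDrop k s' s _ e => wred e g ∘ munit (A k) _ ∘ actm (A k) (u k) (idm _)
  end.

End WordReduction.

Implicit Types m n r : M.

Lemma eq_wred s' s (e : emb s' s) (a : objs) (a' : objs')
    (v1 v2 : forall k', khom (a (ix k')) (a' k'))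
    (u1 u2 : forall k, hom (a k) tunit) m n (g : hom m n) :
  (forall k', v1 k' = v2 k') -> (forall k, ~~ kept k -> u1 k = u2 k) ->
  wred v1 u1 e g = wred v2 u2 e g.
Proof.
move=> ev eu; elim: e => {s' s} [|k' s' s e IH|k s' s nk e IH] //=.
  by rewrite ev IH.
by rewrite eu // IH.
Qed.

Lemma wred_compr s' s (e : emb s' s) (a b : objs) (a' : objs')
    (v : forall k', khom (b (ix k')) (a' k')) (u : forall k, hom (b k) tunit)
    (h : forall k, hom (a k) (b k)) m n r (g : hom n r) (l : hom m n) :
  wred v u e g ∘ wactm s h l =
  wred (fun k' => kcompr (v k') (h (ix k'))) (fun k => u k ∘ h k) e (g ∘ l).
Proof.
elim: e => {s' s} [|k' s' s e IH|k s' s nk e IH] //=.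
  by rewrite kact_compr IH.
rewrite -!ucat_compA -!lm_actm_comp ucat_comp1l.
rewrite -IH -[in RHS]ucat_compA; congr (_ ∘ _).
by rewrite [RHS]ucat_compA -lm_munit_nat -ucat_compA -lm_actm_comp ucat_comp1l ucat_comp1r.
Qed.

Lemma wred_compl s' s (e : emb s' s) (a : objs) (a' b' : objs')
    (v : forall k', khom (a (ix k')) (a' k')) (u : forall k, hom (a k) tunit)
    (h : forall k', hom (a' k') (b' k')) m n r (g : hom m n) (l : hom n r) :
  (wactm (M := M') s' h l) ⊚ wred v u e g =
  wred (fun k' => kcompl (h k') (v k')) u e (l ∘ g).
Proof.
elim: e => {s' s} [|k' s' s e IH|k s' s nk e IH] //=.
  by rewrite kact_compl IH.
by rewrite !ucat_compA IH.
Qed.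

(** Collects the scalars arising at the deleted indices into one factor: the phases of R_1 and the
    normalisations of the fusion bases. *)
Lemma wred_scale s' s (e : emb s' s) (a : objs) (a' : objs')
    (v : forall k', khom (a (ix k')) (a' k')) (u : forall k, hom (a k) tunit)
    (x : K -> R[i]) m n (g : hom m n) :
  wred v (fun k => x k *: u k) e g =
  (\prod_(k <- s | ~~ kept k) x k) *: wred v u e g.
Proof.
elim: e => {s' s} [|k' s' s e IH|k s' s nk e IH] /=.
- by rewrite big_nil scale1r.
- by rewrite big_cons kept_subidx /= IH; case: k' (v k') => i f /=; rewrite actmZr.
- by rewrite big_cons nk actmZl compZr IH !compZl scalerA.
Qed.

Lemma wred_unitary s' s (e : emb s' s) (a : objs) (a' : objs')
    (v : forall k', khom (a (ix k')) (a' k')) (u : forall k, hom (a k) tunit)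
    m n (g : hom m n) :
  (forall k', kunitary (v k')) -> (forall k, ~~ kept k -> unitary (u k)) ->
  unitary g -> unitary (wred v u e g).
Proof.
move=> uv uu ug; elim: e => {s' s} [|k' s' s e IH|k s' s nk e IH] //=.
  exact: kact_unitary.
apply: unitary_comp; last exact: actm_unitary (uu _ nk) (unitary_id _).
by apply: unitary_comp IH _; exact: lm_munit_u.
Qed.

Lemma wred_wunit s' s (e : emb s' s) m n (g : hom m n) :
  (wunit (M := M') s' n) ⊚
    wred kunit (fun k => idm tunit) e g = g ∘ wunit s m.
Proof.
elim: e => {s' s} [|k' s' s e IH|k s' s nk e IH] /=.
- by rewrite ucat_comp1l ucat_comp1r.
- by rewrite -ucat_compA kact_munit !ucat_compA IH.
- by rewrite lm_actm_id ucat_comp1r !ucat_compA IH.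
Qed.

(** A kept letter is passed by naturality of the commutation isomorphism. At a deleted letter,
    [comm_munit] says that the unit may be absorbed before or after the commutation. *)
Lemma wred_wpush s' s (e : emb s' s) k' (c : F (ix k')) (c' : F' k')
    (a : objs) (a' : objs') (f : khom c c')
    (v : forall k', khom (a (ix k')) (a' k')) (u : forall k, hom (a k) tunit)
    m n (g : hom m n) :
  ix k' \notin s ->
  (wpush (M := M') s' c' a' n) ⊚ kact f (wred v u e g) =
  wred v u e (kact f g) ∘ wpush s c a m.
Proof.
elim: e => {s' s} [|l' s' s e IH|l s' s nl e IH] /=.
- by rewrite ucat_comp1l ucat_comp1r.
- rewrite inE negb_or => /andP[kl /IH{}IH].
  rewrite -ucat_compA kact_comm; last by rewrite -(inj_eq (@subidx_inj p q I' J')).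
  rewrite !ucat_compA kact_compl kcompl_id IH kact_compr kcompr_id.
  by [].
- rewrite inE negb_or => /andP[kl /IH{}IH].
  have -> : kact f (wred v u e g ∘ munit (A l) (wact s a m) ∘
               actm (A l) (u l) (idm (wact s a m))) =
      kact f (wred v u e g) ∘ actm (A (ix k')) (idm c)
        (munit (A l) _ ∘ actm (A l) (u l) (idm (wact s a m))).
    by rewrite kact_compr kcompr_id ucat_compA.
  rewrite [LHS]ucat_compA IH -!ucat_compA; congr (_ ∘ _).
  rewrite actm_comp_idl -comm_munit // !ucat_compA.
  rewrite -[wpush _ _ _ _ ∘ _ ∘ _ ∘ _]ucat_compA (comm_nat (mm_coh M kl)).
  rewrite !ucat_compA; congr (_ ∘ _).
  rewrite -lm_munit_nat -!ucat_compA; congr (_ ∘ _).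
  by rewrite -!lm_actm_comp !ucat_comp1l lm_actm_id !ucat_comp1r.
Qed.

(** At a kept letter this is naturality of [massoc] together with [wred_wpush]. A deleted letter
    carries two units, merged by [runit] on the left side and absorbed separately on the right
    side. *)
Lemma wred_wassoc s' s (e : emb s' s) (a b : objs) (a' b' : objs')
    (v1 : forall k', khom (a (ix k')) (a' k'))
    (u1 : forall k, hom (a k) tunit)
    (v2 : forall k', khom (b (ix k')) (b' k'))
    (u2 : forall k, hom (b k) tunit) m n (g : hom m n) :
  uniq s ->
  (wassoc (M := M') s' a' b' n) ⊚
    wred (fun k' => ktens (v1 k') (v2 k'))
         (fun k => runit tunit ∘ tensm (u1 k) (u2 k)) e g =
  wred v1 u1 e (wred v2 u2 e g) ∘ wassoc s a b m.
Proof.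
elim: e => {s' s} [|k' s' s e IH|k s' s nk e IH] /=.
- by rewrite ucat_comp1l ucat_comp1r.
- move=> /andP[ks /IH{}IH].
  rewrite -ucat_compA kact_compl kcompl_id IH.
  rewrite -[X in kact X (_ ∘ _)]kcompr_id -kact_compr !ucat_compA; congr (_ ∘ _).
  rewrite -ucat_compA kact_massoc !ucat_compA; congr (_ ∘ _).
  by rewrite kact_compl kcompl_id kact_compr kcompr_id wred_wpush.
- move=> /andP[ks /IH{}IH].
  rewrite !ucat_compA IH.
  (* The inner unit is taken out of the outer reduction, so that it meets the [wpush] contained in
     [wassoc]. *)
  have -> h : wred v1 u1 e (h ∘ munit (A k) (wact s b m)
        ∘ actm (A k) (u2 k) (idm (wact s b m))) =
      wred v1 u1 e h ∘ wactm s (fun k => idm (a k)) (munit (A k) (wact s b m))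
        ∘ wactm s (fun k => idm (a k)) (actm (A k) (u2 k) (idm (wact s b m))).
    rewrite !wred_compr; apply: eq_wred => [k'|l _]; rewrite ?kcompr_id //.
    by rewrite !ucat_comp1r.
  rewrite -!ucat_compA; congr (_ ∘ _); rewrite !ucat_compA.
  rewrite -lm_munit_nat -[LHS]ucat_compA -lm_actm_comp ucat_comp1l ucat_comp1r.
  (* Pushing the inner unit through the layer [a] and absorbing it there amounts to absorbing it at
     once. *)
  have X : wactm s (fun k => idm (a k)) (munit (A k) (wact s b m))
        ∘ wactm s (fun k => idm (a k)) (actm (A k) (u2 k) (idm (wact s b m)))
        ∘ wpush s (b k) a (wact s b m) =
      munit (A k) _ ∘ actm (A k) (u2 k) (idm _).
    by rewrite -ucat_compA -wpush_nat // ucat_compA wpush_munit // wactm_id.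
  rewrite -[X in X ∘ munit _ _]wactm_comp_idl -lm_munit_nat.
  rewrite -[X in _ = X ∘ _ ∘ _ ∘ _]ucat_compA -lm_actm_comp ucat_comp1l ucat_comp1r.
  rewrite -[X in _ = X ∘ _ ∘ _]ucat_compA -lm_actm_comp ucat_comp1r.
  rewrite wactm_comp_idl X -[in RHS](ucat_comp1l (u1 k)) lm_actm_comp.
  rewrite -[in LHS](ucat_comp1l (wassoc s a b m)) lm_actm_comp [LHS]ucat_compA.
  have -> : actm (A k) (tensm (u1 k) (u2 k)) (wassoc s a b m) =
      actm (A k) (tensm (u1 k) (u2 k)) (idm _) ∘
      actm (A k) (idm (tens (a k) (b k))) (wassoc s a b m).
    by rewrite -lm_actm_comp ucat_comp1l ucat_comp1r.
  (* Both sides now differ only in how two adjacent units are absorbed. *)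
  rewrite -munit_munit [LHS]ucat_compA.
  rewrite -[X in X ∘ _ = _]ucat_compA lm_massoc_nat.
  rewrite !ucat_compA; congr (_ ∘ _ ∘ _).
  by rewrite lm_munit_nat.
Qed.

(** By induction on the letters: a deleted one contributes a ratio of equal dimensions, and a kept
    one the same ratio on both sides, [rqdims] being the restriction of [d]. *)
Lemma wred_wweight (d : qdims M) (s' : seq K') (s : seq K) (e : emb s' s)
    (a : objs) (a' : objs') (v : forall k', khom (a (ix k')) (a' k'))
    (u : forall k, hom (a k) tunit) (x y : irr M)
    (g : hom (wact (M := M') s' a' (irrv x) : M) (irrv y : M)) :
  wweight d (g ⊚ wred v u e (idm (irrv x))) =
  wweight (M := M') (rqdims I' J' d) g ⊚ wred v u e (idm (irrv x)).
Proof.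
elim: e y g => {s' s} [|k' s' s e IH|k s' s nk e IH] y g //=; last first.
  (* Naturality of [munit] moves the absorption of the unit to the outside, where it goes from the
     action on [irrv y] to [irrv y] itself; its weight is therefore d_y / d_y. *)
  have dropE (f : hom (wact (M := M') s' a' (irrv x) : M) (irrv y : M)) :
      f ⊚ (wred v u e (idm (irrv x)) ∘ munit (A k) (wact s a (irrv x))
       ∘ actm (A k) (u k) (idm (wact s a (irrv x)))) =
      (munit (A k) (irrv y) ∘ actm (A k) (u k) (idm (irrv y))) ∘
      actm (A k) (idm (a k)) (f ⊚ wred v u e (idm (irrv x))).
    rewrite -[RHS]ucat_compA -lm_actm_comp ucat_comp1l ucat_comp1r.
    rewrite [in RHS](_ : actm _ _ _ = actm (A k) (idm _) (f ⊚ wred v u e (idm (irrv x)))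
       ∘ actm (A k) (u k) (idm _)); last by rewrite -lm_actm_comp ucat_comp1l ucat_comp1r.
    by rewrite !ucat_compA lm_munit_nat.
  rewrite dropE [LHS]wweight_cons divff ?scale1r; last by rewrite gt_eqF ?qdim_gt0.
  by rewrite IH dropE.
(* [wweight_cons] needs composites through simple objects, so the resolution of the identity
   [sum_bas_dbas] is inserted below the outermost letter; [h z i] is the outer part of each term. *)
pose h z (i : 'I_(hdim (irrv z) (wact (M := M') s' a' (irrv x) : M))) :=
  g ⊚ actm (A' k') (idm (a' k')) (bas i) ⊚ kact (v k') (idm (irrv z)).
have hE z i (f : hom (wact (M := M') s' a' (irrv x) : M) (irrv z : M)) :
    g ⊚ actm (A' k') (idm (a' k')) (bas i)
      ⊚ actm (A' k') (idm (a' k')) f ⊚ kact (v k') (wred v u e (idm (irrv x))) =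
    @h z i ∘ actm (A (ix k')) (idm (a (ix k'))) (f ⊚ wred v u e (idm (irrv x))).
  rewrite /h -[RHS]ucat_compA kact_compr ucat_comp1l kcompr_id.
  by rewrite -[LHS]ucat_compA kact_compl kcompl_id.
transitivity (wweight (s := ix k' :: s) (a := a) d (\sum_(z : irr M)
   \sum_(i < hdim (irrv z) (wact (M := M') s' a' (irrv x) : M))
    @h z i ∘ actm (A (ix k')) (idm (a (ix k'))) (dbas i ⊚ wred v u e (idm (irrv x))))).
  apply: (congr1 (@wweight R p q C D M d (ix k' :: s) a x y)).
  transitivity (g ⊚ actm (A' k') (idm (a' k')) (\sum_(z : irr M)
      \sum_(i < hdim (irrv z) (wact (M := M') s' a' (irrv x) : M)) bas i ∘ dbas i)
      ⊚ kact (v k') (wred v u e (idm (irrv x)))).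
    by rewrite sum_bas_dbas lm_actm_id ucat_comp1r.
  rewrite actm_sumr comp_sumr comp_suml; apply: eq_bigr => z _.
  rewrite actm_sumr comp_sumr comp_suml; apply: eq_bigr => i _.
  by rewrite -hE actm_comp_idl !ucat_compA.
rewrite wweight_sum comp_suml; apply: eq_bigr => z _.
rewrite wweight_sum comp_suml; apply: eq_bigr => i _.
rewrite wweight_cons compZl; congr (_ *: _).
by rewrite hE IH.
Qed.

(** Used to extend both labels and fusion indices. A relation [rel] is used because [T (ix k')] and
    [T' k'] are different types for a variable [k']. *)
Lemma dffun_ext_exists (T : K -> finType) (T' : K' -> finType)
    (rel : forall k', T (ix k') -> T' k' -> Prop) (P : forall k, T k -> Prop) :
  (forall k' y, exists x, rel k' x y) ->
  (forall k, ~~ kept k -> exists x, P k x) ->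
  forall t' : {dffun forall k', T' k'}, exists t : {dffun forall k, T k},
    (forall k, ~~ kept k -> P k (t k)) /\ (forall k', rel k' (t (ix k')) (t' k')).
Proof.
move=> relP PP t'.
(* The condition at [k] quantifies over all [k'] lying above it, with a transport, so that a value
   can be chosen at each [k] separately; injectivity of [ix] leaves one [k'] at most. *)
suff /fin_all_exists[f fP] : forall k, exists x : T k,
    (~~ kept k -> P k x) /\
    (forall k' (e : ix k' = k), rel k' (eq_rect_r T x e) (t' k')).
  exists (finfun f); split=> [k|k']; rewrite ffunE; first by case: (fP k).
  by have [_ /(_ k' erefl)] := fP (ix k').
move=> k; have [/keptP[k' <-]|nk] := boolP (kept k).
  have [x relx] := relP k' (t' k'); exists x; split=> // l' e.
  have el := subidx_inj e; subst l'.
  by rewrite (eq_axiomK e).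
have [x Px] := PP _ nk; exists x; split=> // k' e; exfalso.
by move: nk; rewrite -e kept_subidx.
Qed.

(** * Labels of the subfamily and their extensions *)

Notation labels := (label C D).
Notation labels' := (label (subfam (S := I') C) (subfam (S := J') D)).

Definition klab (k' : K') : irr (F (ix k')) -> irr (F' k') :=
  match k' with inl i => id | inr j => id end.

Definition kdidm (k' : K') : forall (i : irr (F (ix k'))) (i' : irr (F' k')),
    khom (irrv i) (irrv i') :=
  match k' with inl i => fun i i' => didm i i' | inr j => fun i i' => didm i i' end.

Definition extends (a : labels) (a' : labels') : Prop :=
  (forall k, ~~ kept k -> a k = irr1) /\ (forall k', klab (a (ix k')) = a' k').

Lemma klab_inj k' : injective (@klab k').
Proof. by case: k' => k i j. Qed.

Lemma extends_ex a' : exists a, extends a a'.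
Proof.
apply: (@dffun_ext_exists (fun k => irr (F k)) (fun k' => irr (F' k'))
  (fun k' i i' => klab i = i') (fun k i => i = irr1)) => [k' y|k _].
  by case: k' y => i y; exists y.
by exists irr1.
Qed.

Lemma extends_injl a b a' : extends a a' -> extends b a' -> a = b.
Proof.
move=> [a1 a2] [b1 b2]; apply/ffunP => k.
have [/keptP[k' <-]|nk] := boolP (kept k); last by rewrite a1 ?b1.
by apply: klab_inj; rewrite a2 b2.
Qed.

Lemma extends_injr a a' b' : extends a a' -> extends a b' -> a' = b'.
Proof. by move=> [_ a2] [_ b2]; apply/ffunP => k'; rewrite -a2 b2. Qed.

Definition lres (a : labels) : labels' := [ffun k' => klab (a (ix k'))].

Lemma lres_extends (a : labels) (a' : labels') : extends a a' -> lres a = a'.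
Proof. by move=> [_ e]; apply/ffunP => k'; rewrite ffunE e. Qed.

Lemma extends_lres (a : labels) : (forall k, ~~ kept k -> a k = irr1) -> extends a (lres a).
Proof. by move=> a1; split=> // k'; rewrite ffunE. Qed.

Lemma extends_lone : extends (lone C D) (lone _ _).
Proof. by split=> [k _|[] i]; rewrite !ffunE. Qed.

Lemma extends_ldual (a : labels) (a' : labels') : extends a a' -> extends (ldual a) (ldual a').
Proof.
move=> [a1 a2]; split=> [k nk|k']; first by rewrite ffunE a1 // dual_irr1.
by rewrite !ffunE -a2; case: k'.
Qed.

Lemma kdidm_unitary k' (i : irr (F (ix k'))) i' :
  klab i = i' -> kunitary (kdidm i i').
Proof. by case: k' i i' => k i i'; exact: didm_unitary. Qed.

Lemma kcompl_unit_iso k' (i : irr (F (ix k'))) i' : klab i = i' ->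
  kcompl (unit_iso i') (kdidm i i') = kcompr (kunit k') (unit_iso i).
Proof.
by case: k' i i' => k i i' e;
   exact: etrans (unit_iso_didm e) (esym (ucat_comp1l _)).
Qed.

Lemma kcompr_coevR k' (i j : irr (F (ix k'))) i' j' :
  klab i = i' -> j = dual i -> j' = dual i' ->
  kcompr (ktens (kdidm j j') (kdidm i i'))
    (tensm (didm (dual i) j) (idm (irrv i)) ∘ coevR i) =
  kcompl (tensm (didm (dual i') j') (idm (irrv i')) ∘ coevR i') (kunit k').
Proof.
by case: k' i j i' j' => k i j i' j' e ej ej';
   exact: etrans (coevR_didm e ej ej') (esym (ucat_comp1r _)).
Qed.

(** For [g] the identity this is the unitary J. A general [g] allows reductions to be nested, as in
    a (x) (b (x) m). *)
Definition tred (a : labels) (a' : labels') (m n : M) (g : hom m n) :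
    hom (tact a m : M) (tact (M := M') a' n : M) :=
  wred (a := lobj a) (a' := lobj a') (fun k' => kdidm (a (ix k')) (a' k'))
    (fun k => unit_iso (a k)) emb_word g.

Lemma tred_unitary (a : labels) (a' : labels') (m n : M) (g : hom m n) :
  extends a a' -> unitary g -> unitary (tred a a' g).
Proof.
move=> [a1 a2]; apply: wred_unitary => [k'|k nk]; first exact: kdidm_unitary.
exact/unit_iso_unitary/a1.
Qed.

Lemma tred_compr (a : labels) (a' : labels') (m n r : M) (g : hom n r) (h : hom m n) :
  tred a a' g ∘ tactm a h = tred a a' (g ∘ h).
Proof.
rewrite /tred /tactm wred_compr; apply: eq_wred => [k'|k _].
  exact: kcompr_id.
exact: ucat_comp1r.
Qed.

Lemma tred_compl (a : labels) (a' : labels') (m n r : M) (g : hom m n) (h : hom n r) :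
  tactm (M := M') a' h ⊚ tred a a' g = tred a a' (h ∘ g).
Proof.
rewrite /tred /tactm wred_compl; apply: eq_wred => [k'|k _] //.
exact: kcompl_id.
Qed.

Lemma tredE (a : labels) (a' : labels') (m n : M) (h : hom m n) :
  tred a a' h = tactm (M := M') a' h ⊚ tred a a' (idm m).
Proof. by rewrite tred_compl ucat_comp1r. Qed.

Lemma tredK (a : labels) (a' : labels') (m n r : M) (h : hom m n)
    (f : hom r (tact (M := M') a' m : M)) : extends a a' ->
  tred a a' h ∘ ((tred a a' (idm m))^† ⊚ f) = tactm (M := M') a' h ⊚ f.
Proof.
move=> e; have [_ u2] := tred_unitary e (unitary_id m).
by rewrite tredE (@ucat_compA R M) -[X in X ∘ f](@ucat_compA R M) u2 (@ucat_comp1r R M).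
Qed.

Lemma tred_conj (a : labels) (a' : labels') (m n : M) (h : hom m n) :
  extends a a' ->
  tred a a' (idm n) ∘ tactm a h ∘ (tred a a' (idm m))^† = tactm (M := M') a' h.
Proof.
move=> e; rewrite tred_compr ucat_comp1l tredE.
have [_ u2] := tred_unitary e (unitary_id m).
by rewrite -(@ucat_compA R M) u2 (@ucat_comp1r R M).
Qed.

Lemma tred_tunitm (m n : M) (g : hom m n) :
  tunitm (M := M') n ⊚ tred (lone C D) (lone _ _) g = g ∘ tunitm m.
Proof.
rewrite /tunitm /tred -[LHS]ucat_compA wred_compl ucat_comp1l.
rewrite [RHS]ucat_compA -(wred_wunit emb_word) -[RHS]ucat_compA wred_compr ucat_comp1r.
congr (_ ∘ _); apply: eq_wred => [k'|k _]; last first.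
  by rewrite ucat_comp1l.
by apply: kcompl_unit_iso; have [_] := extends_lone.
Qed.

(* y is the product of the phases relating R_1 to the canonical isomorphism at
   the deleted indices. *)
Lemma tred_tcoev (d : qdims M) (a : labels) (a' : labels') (x : irr M) :
  extends a a' -> exists2 y : R[i], y * y^* = 1 &
  forall (m n : M) (g : hom m n), tred (ldual a) (ldual a') (tred a a' g) ∘ tcoev a m =
    y *: (tcoev (M := M') a' n ⊚ g).
Proof.
move=> [a1 a2].
(* The simple object [x] supplies an instance of the defining relation of [d], from which d_1 = 1
   follows. *)
have q1 k : qdimc (irr1 : irr (F k)) = 1.
  exact: qdimc_irr1 (qdim_gt0 d k) (qdim_eq d (k := k) irr1 x).
have /fin_all_exists[y yP] : forall k, exists y : R[i], ~~ kept k -> (y * y^* = 1) /\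
  unit_iso2 (ldual a k) (a k) ∘
    (tensm (didm (dual (a k)) (ldual a k)) (idm (irrv (a k))) ∘ coevR (a k)) =
    y *: idm tunit.
  (* The value 1 at the kept indices is a filler; the product below ranges over the deleted ones. *)
  move=> k; have [kk|nk] := boolP (kept k); first by exists 1.
  have [|y y1 yE] := coevR_unit_scal (a1 _ nk) (l := ldual a k) _ (q1 k).
    by rewrite ffunE.
  by exists y.
exists (\prod_(k <- word p q | ~~ kept k) y k).
  rewrite rmorph_prod -big_split big1 //= => k nk.
  by have [] := yP k nk.
move=> m n g.
rewrite /tcoev /tred !ucat_compA -wred_wassoc ?word_uniq //.
rewrite -[X in X ∘ _]ucat_compA wred_compr ucat_comp1r.
(* [tcoev] begins with the adjoint of [wunit], so [wred_wunit] is needed in its adjoint form. *)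
have wu := unitary_dag_slide (wunit_unitary (word p q) m)
  (wunit_unitary (M := M') (word #|I'| #|J'|) n) (wred_wunit emb_word g).
have -> : tcoev (M := M') a' n ⊚ g =
    wassoc (M := M') (word #|I'| #|J'|) (lobj (ldual a')) (lobj a') n ⊚
    (wactm (M := M') (word #|I'| #|J'|)
      (fun k => tensm (didm (dual (a' k)) (ldual a' k)) (idm (lobj a' k)) ∘
                coevR (a' k)) (idm n) ⊚
     (@dag R M _ _ (wunit (M := M') (word #|I'| #|J'|) n) ⊚ g)).
  by rewrite !ucat_compA.
rewrite -wu [X in _ *: (_ ∘ X)]ucat_compA wred_compl ucat_comp1l [in RHS]ucat_compA.
rewrite -compZl -compZr -wred_scale; congr (_ ∘ _ ∘ _).
apply: eq_wred => [k'|k nk]; last by rewrite -[LHS]/(unit_iso2 _ _ ∘ _); case: (yP k nk).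
by apply: kcompr_coevR => //; rewrite ffunE.
Qed.

(** * Fusion channels of extended labels *)

Notation Fus := (fus (C := C) (D := D)).
Notation Fus' := (fus (C := subfam (S := I') C) (D := subfam (S := J') D)).

(** Indices are compared as natural numbers because the two ordinal types agree only after case
    analysis on [k'] and use of the label equalities; equal numbers then denote the same basis
    vector. *)
Definition fus_extends (c a b : labels) (c' a' b' : labels')
    (t : Fus c a b) (t' : Fus' c' a' b') : Prop :=
  forall k', t (ix k') = t' k' :> nat.

Lemma kcompr_bas k' (c a b : irr (F (ix k'))) c' a' b'
    (t : 'I_(hdim (irrv c) (tens (irrv a) (irrv b))))
    (t' : 'I_(hdim (irrv c') (tens (irrv a') (irrv b')))) :
  klab c = c' -> klab a = a' -> klab b = b' -> t = t' :> nat ->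
  kcompr (ktens (kdidm a a') (kdidm b b')) (bas t) = kcompl (bas t') (kdidm c c').
Proof.
by case: k' c a b c' a' b' t t' => k c a b c' a' b' t t'; exact: bas_didm.
Qed.

Lemma kcompr_dbas k' (c a b : irr (F (ix k'))) c' a' b'
    (t : 'I_(hdim (irrv c) (tens (irrv a) (irrv b))))
    (t' : 'I_(hdim (irrv c') (tens (irrv a') (irrv b')))) :
  klab c = c' -> klab a = a' -> klab b = b' -> t = t' :> nat ->
  kcompr (kdidm c c') (dbas t) = kcompl (dbas t') (ktens (kdidm a a') (kdidm b b')).
Proof.
by case: k' c a b c' a' b' t t' => k c a b c' a' b' t t'; exact: dbas_didm.
Qed.

Lemma hdim_klab k' (c a b : irr (F (ix k'))) c' a' b' :
  klab c = c' -> klab a = a' -> klab b = b' ->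
  hdim (irrv c) (tens (irrv a) (irrv b)) = hdim (irrv c') (tens (irrv a') (irrv b')).
Proof. by case: k' c a b c' a' b' => k c a b c' a' b' /= <- <- <-. Qed.

Section Fusion.

Variables (c a b : labels) (c' a' b' : labels').
Hypotheses (ec : extends c c') (ea : extends a a') (eb : extends b b').

(** At a kept index the entry is a cast of the given one; at a deleted index it comes from the
    nonzero space Hom(1, 1 (x) 1). *)
Lemma fus_extends_exl (t' : Fus' c' a' b') : exists t : Fus c a b, fus_extends t t'.
Proof.
have [|k nk|t [_ tE]] := @dffun_ext_exists
  (fun k => 'I_(hdim (lobj c k) (tens (lobj a k) (lobj b k))))
  (fun k' => 'I_(hdim (lobj c' k') (tens (lobj a' k') (lobj b' k'))))
  (fun k' t t' => t = t' :> nat) (fun k _ => True) _ _ t'; last by exists t.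
  move=> k' y; have e := hdim_klab (ec.2 k') (ea.2 k') (eb.2 k').
  by exists (cast_ord (esym e) y).
have [x _] := fus_unit_ex (ea.1 _ nk) (eb.1 _ nk) (ec.1 _ nk).
by exists x.
Qed.

Lemma fus_extends_exr (t : Fus c a b) : exists t' : Fus' c' a' b', fus_extends t t'.
Proof.
have e k' := hdim_klab (ec.2 k') (ea.2 k') (eb.2 k').
by exists [ffun k' => cast_ord (e k') (t (ix k'))] => k'; rewrite ffunE.
Qed.

Lemma fus_extends_injl (t s : Fus c a b) (t' : Fus' c' a' b') :
  fus_extends t t' -> fus_extends s t' -> t = s.
Proof.
move=> tt' st'; apply/ffunP => k; have [/keptP[k' <-]|nk] := boolP (kept k).
  by apply: val_inj; rewrite /= tt' st'.
exact: fus_unit_uniq (ea.1 _ nk) (eb.1 _ nk) _ _.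
Qed.

Lemma fus_extends_injr (t : Fus c a b) (t' s' : Fus' c' a' b') :
  fus_extends t t' -> fus_extends t s' -> t' = s'.
Proof. by move=> tt' ts'; apply/ffunP => k'; apply: val_inj; rewrite /= -tt' ts'. Qed.

(* The basis vectors of Hom(1, 1 (x) 1) chosen at the deleted indices are not
   normalised, whence y. *)
Lemma tred_fus (t : Fus c a b) (t' : Fus' c' a' b') : fus_extends t t' ->
  exists2 y : R[i], y != 0 & forall (m n : M) (g : hom m n),
    tred a a' (tred b b' g) ∘ tsplit t m =
      y *: (tsplit (M := M') t' n ⊚ tred c c' g) /\
    tred c c' g ∘ tfuse t m =
      y^-1 *: (tfuse (M := M') t' n ⊚ tred a a' (tred b b' g)).
Proof.
move=> tt'.
have /fin_all_exists[y yP] : forall k, exists y : R[i], (y != 0) /\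
    (~~ kept k ->
     unit_iso2 (a k) (b k) ∘ bas (t k) = y *: unit_iso (c k) /\
     unit_iso (c k) ∘ dbas (t k) = y^-1 *: unit_iso2 (a k) (b k)).
  move=> k; have [kk|nk] := boolP (kept k); first by exists 1; rewrite oner_neq0.
  by have [y [y0 E1 E2]] := fus_unit_scal (ea.1 _ nk) (eb.1 _ nk) (t k); exists y.
exists (\prod_(k <- word p q | ~~ kept k) y k).
  by rewrite prodf_seq_neq0; apply/allP => k _; apply/implyP => _; case: (yP k).
move=> m n g; split.
  rewrite /tsplit /tred !ucat_compA -wred_wassoc ?word_uniq //.
  rewrite -[LHS]ucat_compA wred_compr ucat_comp1r.
  rewrite -[in RHS]ucat_compA wred_compl ucat_comp1l -compZr -wred_scale.
  congr (_ ∘ _); apply: eq_wred => [k'|k nk].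
    exact: kcompr_bas (ec.2 _) (ea.2 _) (eb.2 _) (tt' k').
  by have [_ /(_ nk)[]] := yP k.
(* [tfuse] contains the adjoint of [wassoc], so [wred_wassoc] is inverted using unitarity on both
   sides. *)
have wa := unitary_dag_slide
  (wassoc_unitary (M := M) (lobj a) (lobj b) m (word_uniq p q))
  (wassoc_unitary (M := M') (lobj a') (lobj b') n (word_uniq #|I'| #|J'|))
  (wred_wassoc emb_word (fun k' => kdidm (a (ix k')) (a' k'))
     (fun k => unit_iso (a k)) (fun k' => kdidm (b (ix k')) (b' k'))
     (fun k => unit_iso (b k)) g (word_uniq p q)).
rewrite /tfuse /tred !ucat_compA wred_compr ucat_comp1r.
rewrite -[in RHS]ucat_compA -wa [in RHS]ucat_compA wred_compl ucat_comp1l.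
rewrite -compZl -prodfV -wred_scale; congr (_ ∘ _); apply: eq_wred => [k'|k nk].
  exact: kcompr_dbas (ec.2 _) (ea.2 _) (eb.2 _) (tt' k').
by have [_ /(_ nk)[]] := yP k.
Qed.

End Fusion.

(** * The embedding *)

Section Embedding.

(** A choice of extensions, obtained from [extends_ex] by finite choice and unique by
    [extends_injl]. *)
Variable lext : labels' -> labels.
Hypothesis lextP : forall a', extends (lext a') a'.

Lemma lextE a a' : extends a a' -> lext a' = a.
Proof. exact: extends_injl. Qed.

Definition tube_embed (X : vec R (tbasis M')) : vec R (tbasis M) :=
  ext (fun a x z u w (f : hom1 (M := M') a x z) (g : hom2 (M := M') a u w) =>
    pure (M := M) (a := lext a)
      ((tred (lext a) a (idm (irrv z)))^† ⊚ f)
      (g ⊚ tred (lext a) a (idm (irrv u)))) X.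

Lemma tube_embed_linear : linear tube_embed.
Proof. exact: ext_linear. Qed.

Lemma tube_embed_pure (a : labels) (a' : labels') (x z u w : irr M)
    (f : hom1 (M := M') a' x z) (g : hom2 (M := M') a' u w) :
  extends a a' ->
  tube_embed (pure f g) =
  pure (M := M) (a := a) (x := x) (w := w)
    ((tred a a' (idm (irrv z)))^† ⊚ f) (g ⊚ tred a a' (idm (irrv u))).
Proof.
move=> e; rewrite /tube_embed ext_pure ?(lextE e) // => [{}g|{}f] l h h'.
  by rewrite (@ucat_compr R M) pure_linear_l.
by rewrite (@ucat_compl R M) pure_linear_r.
Qed.

Lemma tube_embed_inj : injective tube_embed.
Proof.
(* A left inverse, f (x) g going to J f (x) g J^†. It is defined on all labels through [lres], and
   it inverts the embedding on those that are extensions. *)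
pose psi (Y : vec R (tbasis M)) : vec R (tbasis M') :=
  ext (fun a x z u w (f : hom1 a x z) (g : hom2 a u w) =>
    pure (M := M') (a := lres a) (x := x) (w := w)
      (tred a (lres a) (idm (irrv z)) ⊚ f)
      (g ⊚ (tred a (lres a) (idm (irrv u)))^†)) Y.
have psi_lin : linear psi by exact: ext_linear.
apply: (can_inj (g := psi)); apply: eq_on_pure => //.
  exact: linear_comp tube_embed_linear psi_lin.
move=> a' x z u w f g; have e := lextP a'.
rewrite (tube_embed_pure _ _ e) /psi ext_pure => [|{}g|{}f]; first last.
- by move=> l h h'; rewrite (@ucat_compl R M) pure_linear_r.
- by move=> l h h'; rewrite (@ucat_compr R M) pure_linear_l.
(* The restriction of [lext a'] equals [a'] only propositionally; generalising it allows
   substitution in the dependent types. *)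
move: (lres _) (lres_extends e) => b eb; subst b.
have [_ uz] := tred_unitary e (unitary_id (irrv z)).
have [_ uu] := tred_unitary e (unitary_id (irrv u)).
by rewrite (@ucat_compA R M) uz -(@ucat_compA R M) uu (@ucat_comp1l R M) (@ucat_comp1r R M).
Qed.

Lemma tube_embed_one : tube_embed (tone M') = tone M.
Proof.
rewrite /tone (linear_sum_of _ _ _ tube_embed_linear); apply: eq_bigr => x _.
rewrite (linear_sum_of _ _ _ tube_embed_linear); apply: eq_bigr => u _.
rewrite (tube_embed_pure _ _ extends_lone).
have tE (m : M) : tunitm (M := M') m ⊚ tred (lone C D) (lone _ _) (idm m) = tunitm m.
  by rewrite tred_tunitm ucat_comp1l.
by rewrite -!tE (@ucat_dag_comp R M).
Qed.

Lemma tube_embed_counit X : tcounit (tube_embed X) = tcounit X.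
Proof.
have lin := linear_comp tube_embed_linear (@tcounit_linear R p q C D M).
move: X; apply: (eq_on_pure lin (@tcounit_linear _ _ _ _ _ M')).
move=> a' x z u w f g; have e := lextP a'.
rewrite (tube_embed_pure _ _ e) !tcounit_pure.
(* The Kronecker delta acts between J and J^†, and conjugation by J turns its action on one side
   into its action on the other. *)
congr scal; rewrite -(tred_conj _ e).
by rewrite !(@ucat_compA R M).
Qed.

Lemma tube_embed_comul X :
  tcomul (tube_embed X) = vtens_map tube_embed (tcomul X).
Proof.
have lin1 := linear_comp tube_embed_linear (@tcomul_linear R p q C D M).
have lin2 := linear_comp (@tcomul_linear _ _ _ _ _ M') (vtens_map_linear tube_embed).
move: X; apply: (eq_on_pure lin1 lin2).
move=> a' x z u w f g; have e := lextP a'.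
rewrite (tube_embed_pure _ _ e) !tcomul_pure.
rewrite (linear_sum_of _ _ _ (vtens_map_linear _)); apply: eq_bigr => s _.
rewrite (linear_sum_of _ _ _ (vtens_map_linear _)); apply: eq_bigr => t _.
rewrite (linear_sum_of _ _ _ (vtens_map_linear _)).
have us := tred_unitary e (unitary_id (irrv s)).
have lB1 g' : linear (fun h : hom (irrv t) (tact (lext a') (irrv s)) =>
    vtens (pure (h : hom1 (lext a') t s) (g ⊚ tred (lext a') a' (idm (irrv u))))
      (pure ((tred (lext a') a' (idm (irrv z)))^† ⊚ f) (g' : hom2 (lext a') s t))).
  by move=> l h h'; rewrite pure_linear_l vtens_linear_l.
have lB2 f' : linear (fun h : hom (tact (lext a') (irrv s)) (irrv t) =>
    vtens (pure (f' : hom1 (lext a') t s) (g ⊚ tred (lext a') a' (idm (irrv u))))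
      (pure ((tred (lext a') a' (idm (irrv z)))^† ⊚ f) (h : hom2 (lext a') s t))).
  by move=> l h h'; rewrite pure_linear_r vtens_linear_r.
rewrite (dual_basis_change (irr_simple t) us lB1 lB2); apply: eq_bigr => i _.
by rewrite (vtens_map_vtens _ _ tube_embed_linear) !(tube_embed_pure _ _ e).
Qed.

Lemma tube_embed_antip (d : qdims M) X :
  tube_embed (tantip (rqdims I' J' d) X) = tantip d (tube_embed X).
Proof.
have lin1 := linear_comp (tantip_linear (rqdims I' J' d)) tube_embed_linear.
have lin2 := linear_comp tube_embed_linear (tantip_linear d).
move: X; apply: (eq_on_pure lin1 lin2).
move=> a' x z u w f g; have e := lextP a'; have e' := extends_ldual e.
rewrite (tube_embed_pure _ _ e) !tantip_pure (tube_embed_pure _ _ e').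
have [y y1 tE] := tred_tcoev d x e.
(* J is carried through [tactm] onto [tcoev], where [tE] with the identity for [g] produces the
   phase [y]. *)
have gE (u' w' : irr M) (h : hom2 (M := M') a' u' w') :
    ghat (h ⊚ tred (lext a') a' (idm (irrv u')) : hom2 (lext a') u' w') =
    y *: ((tred (ldual (lext a')) (ldual a') (idm (irrv w')))^† ⊚
          ghat (M := M') h).
  have uw := tred_unitary e' (unitary_id (irrv w')).
  apply: (unitary_cancell uw); rewrite compZr [X in _ *: X](@ucat_compA R M) uw.2.
  rewrite (@ucat_comp1l R M) /ghat ucat_compA tred_compr ucat_comp1l.
  by rewrite -tred_compl -(@ucat_compA R M) tE (@ucat_comp1r R M) compZr.
have fE : fhat ((tred (lext a') a' (idm (irrv z)))^† ⊚ f : hom1 (lext a') x z) =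
    y^* *: (fhat (M := M') f ⊚ tred (ldual (lext a')) (ldual a') (idm (irrv x))).
  have fJ : ((tred (lext a') a' (idm (irrv z)))^† ⊚ f)^† =
      (@dag R M _ _ f) ⊚ tred (lext a') a' (idm (irrv z)).
    by rewrite ucat_dag_comp ucat_dagK.
  (* Taking the adjoint of [gE] at f^† gives the conjugate phase. *)
  rewrite -!ghat_dag fJ gE dagZ.
  by rewrite (@ucat_dag_comp R M) ucat_dagK.
by rewrite /tred (wred_wweight d) gE fE pureZ y1 scale1r.
Qed.

(** * Compatibility with the product *)

Section Product.

Variables (c a b : labels) (c' a' b' : labels').
Hypotheses (ec : extends c c') (ea : extends a a') (eb : extends b b').
Variables (t : Fus c a b) (t' : Fus' c' a' b') (y : R[i]).
Hypothesis yE : forall (m n : M) (g : hom m n),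
  tred a a' (tred b b' g) ∘ tsplit t m =
    y *: (tsplit (M := M') t' n ⊚ tred c c' g) /\
  tred c c' g ∘ tfuse t m =
    y^-1 *: (tfuse (M := M') t' n ⊚ tred a a' (tred b b' g)).

(** After composing with the unitary J of [c], it passes through [tfuse] at the cost of y^-1 and
    becomes the nested J of [a] and [b], which cancels the two adjoints inside. *)
Lemma tube_embed_mul_l (x z x' z' : irr M) (f : hom1 (M := M') a' x z)
    (f' : hom1 (M := M') b' x' z') :
  tfuse t (irrv z') ∘
      tactm a (((tred b b' (idm (irrv z')))^† ⊚ f') ∘ didm z x') ∘
      ((tred a a' (idm (irrv z)))^† ⊚ f) =
  y^-1 *: ((tred c c' (idm (irrv z')))^† ⊚
    (tfuse (M := M') t' (irrv z') ∘ tactm a' (f' ∘ didm z x') ∘ f)).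
Proof.
have [_ ubz] := tred_unitary eb (unitary_id (irrv z')).
have ucz := tred_unitary ec (unitary_id (irrv z')).
apply: (unitary_cancell ucz).
rewrite compZr [X in _ *: X](@ucat_compA R M) ucz.2 (@ucat_comp1l R M).
rewrite -[X in _ ∘ X]ucat_compA [LHS]ucat_compA (yE _).2 compZl.
congr (_ *: _); rewrite -[LHS]ucat_compA [X in _ ∘ X]ucat_compA tred_compr.
have -> : tred b b' (idm (irrv z')) ∘
    ((tred b b' (idm (irrv z')))^† ⊚ f' ∘ didm z x') = f' ⊚ didm z x'.
  by rewrite !(@ucat_compA R M) ubz (@ucat_comp1l R M).
by rewrite tredK // !(@ucat_compA R M).
Qed.

Lemma tube_embed_mul_r (u w u' w' : irr M) (g : hom2 (M := M') a' u w)
    (g' : hom2 (M := M') b' u' w') :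
  (g ⊚ tred a a' (idm (irrv u))) ∘
      tactm a (didm w' u ∘ (g' ⊚ tred b b' (idm (irrv u')))) ∘
      tsplit t (irrv u') =
  y *: ((g ∘ tactm a' (didm w' u ∘ g') ∘ tsplit (M := M') t' (irrv u')) ⊚
    tred c c' (idm (irrv u'))).
Proof.
rewrite -[X in X ∘ _ = _]ucat_compA tred_compr ucat_comp1l.
rewrite [didm w' u ∘ (_ ∘ _)](@ucat_compA R M) -tred_compl.
rewrite -[LHS]ucat_compA -[X in _ ∘ X]ucat_compA (yE _).1 !compZr.
by rewrite !(@ucat_compA R M).
Qed.

End Product.

Lemma tube_embed_mul X Y : tube_embed (tmul X Y) = tmul (tube_embed X) (tube_embed Y).
Proof.
have lin1 := linear_comp (tmul_linear_l Y) tube_embed_linear.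
have lin2 := linear_comp tube_embed_linear (tmul_linear_l (tube_embed Y)).
move: X; apply: (eq_on_pure lin1 lin2) => a' x z u w f g.
have lin3 := linear_comp (tmul_linear_r (pure f g)) tube_embed_linear.
have lin4 := linear_comp tube_embed_linear (tmul_linear_r (tube_embed (pure f g))).
move: Y {lin1 lin2}; apply: (eq_on_pure lin3 lin4) => b' x' z' u' w' f' g'.
have ea := lextP a'; have eb := lextP b'.
rewrite (tube_embed_pure _ _ ea) (tube_embed_pure _ _ eb) !tmul_pure.
rewrite (linear_sum_of _ _ _ tube_embed_linear).
(* The whole family has more labels [c] to sum over; the restriction to extended ones loses
   nothing. *)
apply/esym/(big_functional_rel (r := extends)).
- exact: extends_ex.
- move=> c; case: (boolP [forall k, ~~ kept k ==> (c k == irr1)]) => [/forallP|] c1.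
    left; exists (lres c); apply: extends_lres => k nk.
    exact/eqP/(implyP (c1 k)).
  (* A fusion index over a product of extended labels would force [c] to be the unit at every
     deleted index, so the inner sum is empty here. *)
  right; apply: big1 => t; case/negP: c1; apply/forallP => k; apply/implyP => nk.
  by apply/eqP; exact: fus_unit (ea.1 _ nk) (eb.1 _ nk) (t k).
- exact: extends_injl.
- exact: extends_injr.
move=> c c' ec; rewrite (linear_sum_of _ _ _ tube_embed_linear).
apply: (big_functional_rel (r := @fus_extends c (lext a') (lext b') c' a' b')).
- exact: fus_extends_exl.
- by move=> t; left; exact: fus_extends_exr.
- exact: fus_extends_injl.
- exact: fus_extends_injr.
move=> t t' tt'; rewrite (tube_embed_pure _ _ ec).
have [y y0 yE] := tred_fus ec ea eb tt'.
rewrite (tube_embed_mul_l ec ea eb yE) (tube_embed_mul_r yE).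
by rewrite pureZ mulVf // scale1r.
Qed.

End Embedding.

Lemma tube_embedding (d : qdims M) :
  exists phi : vec R (tbasis M') -> vec R (tbasis M),
    weak_hopf_embedding (tube (rqdims I' J' d)) (tube d) phi.
Proof.
have [lext lextP] := fin_all_exists extends_ex.
exists (tube_embed lext); split.
- exact: tube_embed_linear.
- exact: tube_embed_inj.
- exact: tube_embed_mul.
- exact: tube_embed_one.
- exact: tube_embed_comul.
- exact: tube_embed_counit.
- exact: tube_embed_antip.
Qed.

End Restriction.

Theorem proposition13 (R : realType) (N p q : nat)
    (C : 'I_p -> fusion_cat R) (D : 'I_q -> fusion_cat R)
    (M : multimodule C D) (d : qdims M) :
  (p + q = N)%N ->
  indecomposable M ->
  forall (k : nat) (I' : {set 'I_p}) (J' : {set 'I_q}),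
    (1 <= k <= N)%N ->
    (#|I'| + #|J'| = k)%N ->
    exists phi : vec R (tbasis (mm_restrict M I' J')) -> vec R (tbasis M),
      weak_hopf_embedding (tube (rqdims I' J' d)) (tube d) phi.
Proof. by move=> _ _ k I' J' _ _; exact: tube_embedding. Qed.
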